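(* For all positive integers $m$ and $n$, the following identity holds in $\mathcal{A}_1$: $$R_{n}^{(m,1)} =\frac{n!}{m}\sum_{\substack{1\le \ell\le \lfloor n/3 \rfloor\\ k_1+\dots+k_\ell=m,\ k_j\ge 1\ \forall j \\ a_1+\dots+a_\ell\vdash n }}\ \prod_{j=1}^{\ell-1}\frac{1}{k_1+\cdots+k_j}\ \prod_{j=1}^\ell \left[\binom{k_j+a_j-1}{a_j}-\binom{k_j}{a_j}\right] \mathfrak{b}_{a_j}.$$
   Context: For a prime $p$ and positive integers $n,m,r$, $R_n^{(m)}(p^r):=\sum \frac{1}{l_1\cdots l_n}$, summed over positive integers $l_1,\dots,l_n$ not divisible by $p$ with $l_1+\dots+l_n=mp^r$. Let $\mathcal{A}_\ell:=\prod_{p}(\mathbb{Z}/p^\ell\mathbb{Z})/\bigoplus_{p}(\mathbb{Z}/p^\ell\mathbb{Z})$ over all primes $p$; a family of rationals $(x_p)_p$ which are $p$-integral for all large $p$ defines an element of $\mathcal{A}_\ell$ by reduction mod $p^\ell$, and two such families are equal in $\mathcal{A}_\ell$ iff $x_p\equiv y_p \pmod{p^\ell}$ for all sufficiently large primes $p$. $R_n^{(m,r)}:=(R_n^{(m)}(p^r) \bmod p^r)_p\in\mathcal{A}_r$. The $\mathcal{A}$-Bernoulli number is $\mathfrak{b}_k:=(-B_{p-k}/k \bmod p)_{p>k}\in\mathcal{A}_1$, where $B_j$ is the $j$-th Bernoulli number. The condition $a_1+\dots+a_\ell\vdash n$ means $a_1,\dots,a_\ell$ are odd integers $\ge3$ with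 sum $n$ (ordered tuples). *)

(* Defs.v *)
From HB Require Import structures.
From mathcomp Require Import all_boot all_order all_algebra.
From mathcomp Require Import ring_quotient.
From mathcomp Require Import boolp classical_sets functions cardinality.

Set Implicit Arguments.
Unset Strict Implicit.
Unset Printing Implicit Defensive.

Import GRing.Theory.
Local Open Scope ring_scope.

Definition primeT := {p : nat | prime p}.

(* MathComp's ['Z_k] is Z/kZ only for [1 < k], so for [l = 0] the factors below
   are Z/2Z; only [l > 0] is meaningful. *)
Definition prodZ (l : nat) := forall p : primeT, 'Z_(sval p ^ l).

Section ProdZ.
Variable l : nat.

HB.instance Definition _ := Choice.copy (prodZ l)
  (forall p : primeT, 'Z_(sval p ^ l)).

Implicit Types f g h : prodZ l.

Lemma prodZ_ext f g : (forall p, f p = g p) -> f = g.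
Proof. exact: functional_extensionality_dep. Qed.

Let zero : prodZ l := fun=> 0.
Let one : prodZ l := fun=> 1.
Let opp f : prodZ l := fun p => - f p.
Let add f g : prodZ l := fun p => f p + g p.
Let mul f g : prodZ l := fun p => f p * g p.

Let addA : associative add.
Proof. by move=> f g h; apply/prodZ_ext => p; apply: addrA. Qed.
Let addC : commutative add.
Proof. by move=> f g; apply/prodZ_ext => p; apply: addrC. Qed.
Let add0 : left_id zero add.
Proof. by move=> f; apply/prodZ_ext => p; apply: add0r. Qed.
Let addN : left_inverse zero opp add.
Proof. by move=> f; apply/prodZ_ext => p; apply: addNr. Qed.

HB.instance Definition _ := GRing.isZmodule.Build (prodZ l) addA addC add0 addN.

Let mulA : associative mul.
Proof. by move=> f g h; apply/prodZ_ext => p; apply: mulrA. Qed.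
Let mulC : commutative mul.
Proof. by move=> f g; apply/prodZ_ext => p; apply: mulrC. Qed.
Let mul1 : left_id one mul.
Proof. by move=> f; apply/prodZ_ext => p; apply: mul1r. Qed.
Let mulD : left_distributive mul add.
Proof. by move=> f g h; apply/prodZ_ext => p; apply: mulrDl. Qed.
Let one_neq0 : one != zero.
Proof.
apply/eqP => /(congr1 (fun f : prodZ l => f (exist _ 2%N isT))) /eqP.
by rewrite /one /zero oner_eq0.
Qed.

HB.instance Definition _ :=
  GRing.Zmodule_isComNzRing.Build (prodZ l) mulA mulC mul1 mulD one_neq0.

End ProdZ.

Definition dsumZ (l : nat) : {pred prodZ l} :=
  fun f => `[< finite_set [set p : primeT | f p != 0]%classic >].
Arguments dsumZ : clear implicits.

Lemma finite_primesP (A : set primeT) :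
  finite_set A <-> exists N, forall p, A p -> (sval p <= N)%N.
Proof.
split.
  move=> /finite_seqP[s ->]; exists (\max_(p <- s) sval p)%N => p /= ps.
  exact: leq_bigmax_seq.
case=> N AN.
pose s : seq primeT := pmap insub (iota 0 N.+1).
apply: (sub_finite_set (B := [set` s]%classic)) => // p /AN pN /=.
by rewrite /s mem_pmap_sub mem_iota add0n ltnS.
Qed.

Lemma dsumZP l (f : prodZ l) :
  reflect (exists N, forall p : primeT, (N < sval p)%N -> f p = 0)
          (f \in dsumZ l).
Proof.
apply: (iffP (asboolP _)) => [/finite_primesP[N H]|[N H]].
  exists N => p; rewrite ltnNge => Np; apply/eqP; apply: contraNT Np; exact: H.
apply/finite_primesP; exists N => p /=; rewrite leqNgt.
by apply: contraNN => Np; apply/eqP/H.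
Qed.

Lemma dsumZ_idealr l : idealr_closed (dsumZ l).
Proof.
split.
- by apply/dsumZP; exists 0%N.
- apply/negP => /dsumZP[N H].
  have [q Nq q_pr] := prime_above N.
  by have /eqP := H (exist _ q q_pr) Nq; rewrite oner_eq0.
- move=> a f g /dsumZP[N Nf] /dsumZP[M Mg]; apply/dsumZP.
  exists (maxn N M) => p; rewrite gtn_max => /andP[/Nf fp /Mg gp].
  by rewrite -[LHS]/(a p * f p + g p) fp gp mulr0 addr0.
Qed.

HB.instance Definition _ (l : nat) :=
  isIdealr.Build (prodZ l) (dsumZ l) (@dsumZ_idealr l).

Definition A_ (l : nat) := {ideal_quot (dsumZ l)}.
HB.instance Definition _ (l : nat) := GRing.ComNzRing.on (A_ l).

(* [ratr x : 'Z_(p ^ l)] is the quotient of the images of the numerator and the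
   denominator of [x], hence the reduction of [x] mod p^l when [x] is
   p-integral; otherwise it is a junk value. The class in [A_ l] is therefore
   the intended one as soon as [x p] is p-integral for all large [p]. *)
Definition redA (l : nat) (x : nat -> rat) : A_ l :=
  \pi_(A_ l)%qT ((fun p => ratr (x (sval p))) : prodZ l).

Lemma redA_eqP (l : nat) (x y : nat -> rat) :
  redA l x = redA l y <->
  exists N, forall p, prime p -> (N < p)%N ->
    ratr (x p) = ratr (y p) :> 'Z_(p ^ l).
Proof.
rewrite /redA; split.
  move=> /eqP; rewrite -Quotient.idealrBE => /dsumZP[N H].
  exists N => p p_pr Np.
  exact/eqP/(etrans (esym (subr_eq0 _ _)))/eqP/(H (exist _ p p_pr) Np).
case=> N H; apply/eqP; rewrite -Quotient.idealrBE; apply/dsumZP.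
exists N => -[p p_pr] Np.
by apply/eqP; rewrite subr_eq0; apply/eqP; apply: H.
Qed.

Definition ratA (l : nat) (c : rat) : A_ l := redA l (fun=> c).

(* Tuples of positive integers with a given sum have entries bounded by that sum,
   so here and below they are finite functions into a bounded ['I_]. *)
Definition Rsum (n m p r : nat) : rat :=
  \sum_(l : {ffun 'I_n -> 'I_(m * p ^ r).+1}
         | [forall i, (0 < l i)%N && ~~ (p %| l i)%N]
           && (\sum_i l i == m * p ^ r)%N)
    (\prod_i (l i)%:R)^-1.

Definition RA (n m r : nat) : A_ r := redA r (fun p => Rsum n m p r).

Fixpoint bernoulli_seq (n : nat) : seq rat :=
  if n is n'.+1 then
    let s := bernoulli_seq n' in
    rcons s (- (n'.+2%:R^-1 * \sum_(i < n'.+1) 'C(n'.+2, i)%:R * s`_i))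
  else [:: 1].

Definition bernoulli (n : nat) : rat := (bernoulli_seq n)`_n.

Lemma size_bernoulli_seq n : size (bernoulli_seq n) = n.+1.
Proof. by elim: n => //= n IH; rewrite size_rcons IH. Qed.

Lemma nth_bernoulli_seq n i : (i <= n)%N -> (bernoulli_seq n)`_i = bernoulli i.
Proof.
elim: n => [|n IH]; first by rewrite leqn0 => /eqP->.
rewrite leq_eqVlt => /orP[/eqP-> //|]; rewrite ltnS => le_in.
by rewrite /= nth_rcons size_bernoulli_seq ltnS le_in IH.
Qed.

Lemma bernoulliP n :
  \sum_(i < n.+1) 'C(n.+1, i)%:R * bernoulli i = (n == 0)%:R :> rat.
Proof.
case: n => [|n]; first by rewrite big_ord_recl big_ord0 addr0 mul1r.
rewrite big_ord_recr /= {2}/bernoulli /= nth_rcons size_bernoulli_seq ltnn eqxx.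
rewrite (eq_bigr (fun i : 'I_n.+1 => 'C(n.+2, i)%:R * (bernoulli_seq n)`_i)).
  rewrite binSn mulrN mulrA mulfV ?mul1r ?subrr //.
  by rewrite Num.Theory.pnatr_eq0.
by move=> i _; rewrite nth_bernoulli_seq // -ltnS.
Qed.

(* The values at the finitely many primes [p <= k] are irrelevant in [A_ 1].
   For odd [k >= 3] the entries at [p > k] are p-integral (von Staudt-Clausen). *)
Definition bA (k : nat) : A_ 1 :=
  redA 1 (fun p => if (k < p)%N then - bernoulli (p - k) / k%:R else 0).

Definition compositions (l m : nat) : {set {ffun 'I_l -> 'I_m.+1}} :=
  [set k : {ffun 'I_l -> 'I_m.+1} | [forall j, (0 < k j)%N]
                                     && (\sum_j k j == m)%N]%SET.

Definition odd_compositions (l n : nat) : {set {ffun 'I_l -> 'I_n.+1}} :=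
  [set a : {ffun 'I_l -> 'I_n.+1} | [forall j, (3 <= a j)%N && odd (a j)]
                                     && (\sum_j a j == n)%N]%SET.

(* Main.v *)
(* Fix a large prime p and put L = \sum_(0 < j < p) x^j / j over F_p. Since
   1 / (pq + j) = 1 / j, [R_n^(m)] is modulo p the coefficient of y^m, y = x^p, in
   the part of (L / (1 - y))^n supported on exponents divisible by p ([ptrace]).
   That part kills images of x d/dx, and (1 - x) x L' = x - y, so integration by
   parts in [ptrace (x^i e^(tL))] gives a two-term recursion in i, a finite form
   of the Beta integral. Hence J = [ptrace (e^(tL))] satisfies dJ/dt = S J, where
   - S = \sum_j (1 / j) \prod_(i < j) (i - u) \prod_(j < i < p) (i - t) modulo
   t^(p - 1), with u = ty. Finite differences in u evaluate S: its expansion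
   involves the Faulhaber polynomials, so the Bernoulli numbers, and
   S = \sum_a b_a t^(a - 1) (1 - y^a - (1 - y)^a). Replacing t by t / (1 - y),
   the generating function of R_n^(m) / n! is the exponential of
   \sum_(a, k) (1 / k) (C(k + a - 1, a) - C(k, a)) b_a t^a y^k. The right-hand side
   of the theorem is the iterated solution of the differential equation in y
   satisfied by this exponential. *)
Require Import Defs.
From HB Require Import structures.
From mathcomp Require Import all_boot all_order all_algebra.
From mathcomp Require Import zify ring ring_quotient.

Set Implicit Arguments.
Unset Strict Implicit.
Unset Printing Implicit Defensive.

Import GRing.Theory Num.Theory.
Local Open Scope ring_scope.

(** * Faulhaber polynomials *)


Lemma bin_mul_bin n k j : (k + j <= n)%N ->
  ('C(n, k) * 'C(n - k, j) = 'C(n, j) * 'C(n - j, k))%N.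
Proof.
move=> le_n.
have key a b : (a + b <= n)%N ->
    ('C(n, a) * 'C(n - a, b) * (a`! * b`! * (n - a - b)`!) = n`!)%N.
  move=> ab; rewrite -(@bin_fact n a); last by lia.
  rewrite -(@bin_fact (n - a) b); last by lia.
  by ring.
apply/eqP; rewrite -(eqn_pmul2r (m := k`! * j`! * (n - k - j)`!)); last first.
  by rewrite !muln_gt0 !fact_gt0.
rewrite key //; apply/eqP; rewrite -(key j k); last by lia.
by rewrite (mulnC k`!) subnAC.
Qed.

(** The recurrence is bounded by [N] because modulo p it only makes sense up to n = p - 2: the
    denominator of B_(p-1) is divisible by p. *)
Definition bern_rec (R : comNzRingType) (b : nat -> R) (N : nat) :=
  forall n, (n <= N)%N -> \sum_(i < n.+1) 'C(n.+1, i)%:R * b i = (n == 0)%:R.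

(** This is B_(i+1)(x) - B_(i+1), that is i + 1 times the power-sum polynomial; leaving out the
    division keeps it meaningful over any commutative ring. *)
Definition faulhaber (R : comNzRingType) (b : nat -> R) (i : nat) (x : R) : R :=
  \sum_(k < i.+1) 'C(i.+1, k)%:R * b k * x ^+ (i.+1 - k).

(** After expanding (x + 1)^(i+1-k) and exchanging the sums, the coefficient of x^j is C(i+1, j)
    times the Bernoulli recurrence of order i - j, which leaves only j = i. *)
Lemma faulhaberS (R : comNzRingType) (b : nat -> R) (i : nat) (x : R) :
  bern_rec b i -> faulhaber b i (x + 1) = faulhaber b i x + i.+1%:R * x ^+ i.
Proof.
move=> bP.
suff <- : faulhaber b i (x + 1) - faulhaber b i x = i.+1%:R * x ^+ i by ring.
rewrite /faulhaber -sumrB.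
transitivity (\sum_(k < i.+1) \sum_(j < i.+1 | (k + j < i.+1)%N)
   'C(i.+1, j)%:R * x ^+ j * ('C(i.+1 - j, k)%:R * b k)).
  apply: eq_bigr => k _; have lt_k := ltn_ord k; rewrite -mulrBr exprD1n.
  have -> : (i.+1 - k = (i - k).+1)%N by lia.
  rewrite big_ord_recr /= binn mulr1n addrK.
  rewrite (big_ord_widen_cond i.+1 xpredT (fun j => x ^+ j *+ 'C((i - k).+1, j))); last by lia.
  rewrite mulr_sumr; apply: eq_big => [j|j kj] /=; first by apply/idP/idP; lia.
  have {}kj : (k + j <= i.+1)%N by lia.
  have := bin_mul_bin kj; have -> : (i.+1 - k = (i - k).+1)%N by lia.
  move=> /(congr1 (fun z : nat => z%:R : R)); rewrite !natrM => E.
  rewrite -mulr_natr.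
  transitivity ('C(i.+1, k)%:R * 'C((i - k).+1, j)%:R * (b k * x ^+ j)).
    by ring.
  by rewrite E; ring.
rewrite (exchange_big_dep xpredT) //=.
rewrite big_ord_recr /= big1 ?add0r => [|j _]; last have lt_j := ltn_ord j.
  rewrite (big_pred1 ord0) => [|k].
    rewrite binSn subSnn bin0 mul1r -[b _]mul1r.
    have := bP 0%N isT; rewrite big_ord_recl big_ord0 addr0 bin0 /= => ->.
    by rewrite mulr1.
  by rewrite /= -val_eqE /=; apply/idP/idP; lia.
rewrite -mulr_sumr (_ : \sum_(_ < _ | _) _ = 0) ?mulr0 //.
have bPj := bP (i - j)%N ltac:(lia).
have E : (i - j == 0)%N = false by lia.
rewrite E in bPj; apply: etrans bPj; symmetry.
rewrite (big_ord_widen_cond i.+1 xpredT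
  (fun k => 'C((i - j).+1, k)%:R * b k)); last by lia.
apply: eq_big => [k|k _] /=; first by apply/idP/idP; lia.
by have -> : (i.+1 - j = (i - j).+1)%N by lia.
Qed.

Lemma faulhaber0 (R : comNzRingType) (b : nat -> R) (i : nat) : faulhaber b i 0 = 0.
Proof.
rewrite /faulhaber big1 // => k _; have lt_k := ltn_ord k.
by rewrite expr0n (_ : i.+1 - k == 0 = false)%N ?mulr0 //; lia.
Qed.

Lemma faulhaber_sum (R : comNzRingType) (b : nat -> R) (i s : nat) :
  bern_rec b i -> faulhaber b i s%:R = i.+1%:R * \sum_(x < s) x%:R ^+ i.
Proof.
move=> bP; elim: s => [|s IH]; first by rewrite faulhaber0 big_ord0 mulr0.
by rewrite -addn1 natrD faulhaberS // IH addn1 big_ord_recr /= mulrDr.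
Qed.

Lemma rmorph_faulhaber (R S : comNzRingType) (f : {rmorphism R -> S}) b i x :
  f (faulhaber b i x) = faulhaber (f \o b) i (f x).
Proof.
rewrite rmorph_sum; apply: eq_bigr => k _.
by rewrite !rmorphM rmorphXn /= rmorph_nat.
Qed.

Lemma rmorph_bern_rec (R S : comNzRingType) (f : {rmorphism R -> S}) b N :
  bern_rec b N -> bern_rec (f \o b) N.
Proof.
move=> bP n nN; rewrite -(rmorph_nat f) -bP // rmorph_sum.
by apply: eq_bigr => k _; rewrite rmorphM rmorph_nat.
Qed.

Lemma horner_faulhaber (R : comNzRingType) (b : nat -> R) i (u : {poly R}) x :
  (faulhaber (polyC \o b) i u).[x] = faulhaber b i u.[x].
Proof.
rewrite -(horner_evalE x (faulhaber _ i u)) rmorph_faulhaber.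
by apply: eq_bigr => k _ /=; rewrite /horner_eval hornerC.
Qed.

Lemma size_faulhaber (R : comNzRingType) (b : nat -> R) i :
  (size (faulhaber (polyC \o b) i 'X) <= i.+2)%N.
Proof.
apply: (leq_trans (size_sum _ _ _)); apply/bigmax_leqP => k _ /=.
rewrite -polyC_natr -polyCM mul_polyC; apply: leq_trans (size_scale_leq _ _) _.
by rewrite size_polyXn; lia.
Qed.

(* Both sides of the reflection [S(1 - u) = S(u)] of the Faulhaber polynomial of
   odd degree [i] have the same finite difference; its linear coefficient is
   [b i]. *)
Lemma bern_odd0 (b : nat -> rat) (i : nat) :
  bern_rec b i -> odd i -> (1 < i)%N -> b i = 0.
Proof.
move=> bP odd_i i_gt1.
pose B k := (b k)%:P.
have BP : bern_rec B i by apply: (rmorph_bern_rec polyC bP).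
pose S := faulhaber B i.
have S_horner u x : (S u).[x] = faulhaber b i u.[x] by apply: horner_faulhaber.
have S_sub1 u : S (1 - u) = S (- u) - i.+1%:R * u ^+ i.
  rewrite [1 - u]addrC /S faulhaberS // exprNn -signr_odd odd_i mulN1r.
  by rewrite mulrN.
have SE : S 'X = S (1 - 'X).
  apply/eqP; rewrite -subr_eq0; apply/eqP.
  set D := S 'X - S (1 - 'X).
  have D0 s : D.[s%:R] = 0.
    rewrite /D hornerD hornerN !S_horner !hornerE.
    elim: s => [|s IH].
      rewrite subr0 -{2}[1]add0r faulhaberS // faulhaber0 expr0n.
      by rewrite (_ : (i == 0)%N = false) ?mulr0 ?addr0 ?subr0 //; lia.
    rewrite -natr1 faulhaberS // opprD addrCA subrr addr0 -IH.
    rewrite [1 - _]addrC faulhaberS // exprNn -signr_odd odd_i.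
    by ring.
  apply: (@roots_geq_poly_eq0 _ _ [seq s%:R | s <- iota 0 (size D)]).
  - by apply/allP => x /mapP[s _ ->]; apply/rootP/D0.
  - by rewrite map_inj_uniq ?iota_uniq // => x y /eqP; rewrite eqr_nat => /eqP.
  - by rewrite size_map size_iota.
have coef1 c : (S (c *: 'X))`_1 = i.+1%:R * b i * c.
  rewrite coef_sum big_ord_recr /= big1 => [|k _].
    rewrite add0r subSnn expr1 binSn -polyC_natr -polyCM -scalerAr.
    by rewrite coefZ coefCM coefX mulr1 mulrC.
  rewrite exprZn -scalerAr coefZ -polyC_natr -polyCM coefCM coefXn.
  have lt_k := ltn_ord k.
  by rewrite (_ : (1 == i.+1 - k)%N = false) ?mulr0 //; lia.
have := congr1 (fun q : {poly rat} => q`_1) SE; rewrite S_sub1 coefB.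
rewrite -[in LHS](scale1r 'X) -(scaleN1r 'X) !coef1 -polyC_natr coefCM coefXn.
have -> : (1 == i)%N = false by lia.
rewrite mulr0 subr0 mulr1 mulrN1 => /eqP.
by rewrite -addr_eq0 -mulr2n mulrn_eq0 mulf_eq0 pnatr_eq0 /= => /eqP.
Qed.

(** * A terminating hypergeometric sum in characteristic p *)


Lemma natr_neq0_ltp (R : nzRingType) (p i : nat) :
  p \in [pchar R] -> (0 < i < p)%N -> i%:R != 0 :> R.
Proof.
move=> pR /andP[i_gt0 lt_ip]; rewrite -(dvdn_pcharf pR).
by apply/negP => /(dvdn_leq i_gt0); lia.
Qed.

Lemma natr_inj_ltp (R : nzRingType) (p i j : nat) : p \in [pchar R] ->
  (i < p)%N -> (j < p)%N -> i%:R = j%:R :> R -> i = j.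
Proof.
move=> pR; wlog le_ij : i j / (i <= j)%N => [hw ip jp E|ip jp E].
  by case: (leqP i j) => [/hw|/ltnW/hw] ->.
apply/eqP; rewrite eqn_leq le_ij leqNgt; apply/negP => lt_ij.
have := @natr_neq0_ltp R p (j - i) pR ltac:(lia).
by rewrite natrB // E subrr eqxx.
Qed.

Lemma natr_fermat (R : idomainType) (p v : nat) : p \in [pchar R] ->
  (0 < v < p)%N -> v%:R ^+ p.-1 = 1 :> R.
Proof.
move=> pR vp; have v0 := natr_neq0_ltp pR vp.
apply: (mulfI v0); rewrite mulr1 -exprS prednK; last by lia.
rewrite -natrX -(GRing.natr_mod_pchar pR) (fermat_little _ (pcharf_prime pR)).
by rewrite (GRing.natr_mod_pchar pR).
Qed.

Lemma poly_eq0_ltp (R : idomainType) (p : nat) (P : {poly R}) : p \in [pchar R] ->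
  (size P <= p)%N -> (forall s, (s < p)%N -> P.[s%:R] = 0) -> P = 0.
Proof.
move=> pR szP P0.
apply: (@roots_geq_poly_eq0 _ _ [seq s%:R | s <- iota 0 p]).
- apply/allP => x /mapP[s]; rewrite mem_iota => /andP[_ sp] ->.
  by apply/rootP/P0.
- rewrite map_inj_in_uniq ?iota_uniq // => x y; rewrite !mem_iota /= !add0n => xp yp.
  exact: natr_inj_ltp pR xp yp.
- by rewrite size_map size_iota.
Qed.

Lemma size_prod_CsubX (R : idomainType) (F : nat -> R) (j : nat) :
  (size (\prod_(i < j) ((F i)%:P - 'X))%R <= j.+1)%N.
Proof.
elim: j => [|j IH]; first by rewrite big_ord0 size_poly1.
rewrite big_ord_recr /=; apply: leq_trans (size_polyMleq _ _) _.
have -> : size ((F j)%:P - 'X) = 2%N by rewrite -opprB size_polyN size_XsubC.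
by rewrite addn2.
Qed.

(** The difference of the two sides has degree below p and vanishes at every residue, by Wilson at 0
    and by Fermat elsewhere. *)
Lemma prod_natr_sub (R : idomainType) (p : nat) (t : R) : p \in [pchar R] ->
  \prod_(1 <= i < p) (i%:R - t) = t ^+ p.-1 - 1.
Proof.
move=> pR; have p_gt1 := prime_gt1 (pcharf_prime pR).
pose P : {poly R} := \prod_(i < p.-1) (i.+1%:R%:P - 'X) - ('X^(p.-1) - 1).
have PE x : P.[x] = \prod_(1 <= i < p) (i%:R - x) - (x ^+ p.-1 - 1).
  rewrite /P !hornerE horner_prod big_add1 big_mkord; congr (_ - _).
  by apply: eq_bigr => i _; rewrite !hornerE.
suff P0 : P = 0 by apply/eqP; rewrite -subr_eq0 -PE P0 horner0.
apply: (poly_eq0_ltp pR) => [|s sp].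
  apply: leq_trans (size_polyD _ _) _; rewrite geq_max size_polyN.
  rewrite -polyC1 size_XnsubC; last by lia.
  by apply/andP; split; [apply: leq_trans (size_prod_CsubX (fun i => i.+1%:R) _) _|]; lia.
rewrite PE; case: s sp => [|s] sp.
  have -> : \prod_(1 <= i < p) (i%:R - 0) = (p.-1)`!%:R :> R.
    rewrite fact_prod prednK; last by lia.
    by rewrite natr_prod; apply: eq_bigr => i _; rewrite subr0.
  have := Wilson p_gt1; rewrite (pcharf_prime pR) => /esym.
  rewrite (dvdn_pcharf pR) -natr1 => /eqP W; rewrite expr0n.
  by rewrite (_ : p.-1 == 0 = false)%N ?sub0r ?opprK //; lia.
rewrite (@natr_fermat _ p) // subrr subr0 (bigD1_seq s.+1) ?iota_uniq //=.
  by rewrite subrr mul0r.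
by rewrite mem_index_iota.
Qed.

Definition hyp_sum (R : nzRingType) (p : nat) (w : nat -> R) (u t : R) : R :=
  \sum_(1 <= j < p) w j * \prod_(i < j) (i%:R - u) * \prod_(j.+1 <= i < p) (i%:R - t).

Lemma hyp_sum0 (R : idomainType) (p : nat) (w : nat -> R) (t : R) :
  hyp_sum p w 0 t = 0.
Proof.
rewrite /hyp_sum big_add1 big1 // => j _.
by rewrite big_ord_recl /= subr0 mul0r mulr0 mul0r.
Qed.

(* The difference in [u] cancels the weights [1 / j], after which the sum
   telescopes. *)
Lemma hyp_sum_diff (R : idomainType) (p : nat) (w : nat -> R) (v : nat) (t : R) :
  p \in [pchar R] -> (forall j, (0 < j < p)%N -> w j * j%:R = 1) ->
  (v.+1 < p)%N -> v.+1%:R != t ->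
  hyp_sum p w v.+1%:R t =
    hyp_sum p w v%:R t + \sum_(i < p.-1) t ^+ (p.-1.-1 - i) * v.+1%:R ^+ i.
Proof.
move=> pR wP vp vt.
have vt0 : t - v.+1%:R != 0 by rewrite subr_eq0 eq_sym.
suff D : hyp_sum p w v.+1%:R t - hyp_sum p w v%:R t =
    \sum_(i < p.-1) t ^+ (p.-1.-1 - i) * v.+1%:R ^+ i by rewrite -D; ring.
(* Multiplying by t - (v + 1) turns the geometric sum into t^(p-1) - 1, which is the product of all
   i - t. *)
apply: (mulfI vt0); rewrite -subrXX (@natr_fermat _ p) // -prod_natr_sub //.
rewrite /hyp_sum -sumrB mulr_sumr.
pose A j : R := \prod_(i < j) (i%:R - v%:R).
pose Q j : R := \prod_(j.+1 <= i < p) (i%:R - t).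
have Aend : A p.-1 = 0.
  have lt_v : (v < p.-1)%N by lia.
  by rewrite /A (bigD1 (Ordinal lt_v)) //= subrr mul0r.
have -> : \prod_(1 <= i < p) (i%:R - t) = - (A p.-1 * Q p.-1 - A 0%N * Q 0%N).
  by rewrite Aend mul0r /A big_ord0 /Q; ring.
rewrite -(telescope_sumr (fun j => A j * Q j)); last by lia.
rewrite big_add1 -sumrN; apply: eq_big_nat => j jp.
have -> : \prod_(i < j.+1) (i%:R - v.+1%:R) = A j * (- v.+1%:R) :> R.
  rewrite big_ord_recl mulrC sub0r; congr (_ * _).
  by apply: eq_bigr => i _; rewrite lift0 -!natr1; ring.
have -> : \prod_(i < j.+1) (i%:R - v%:R) = A j * (j%:R - v%:R) :> R.
  by rewrite big_ord_recr.
have -> : Q j = (j.+1%:R - t) * Q j.+1 by rewrite /Q big_ltn //; lia.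
have -> : A j.+1 = A j * (j%:R - v%:R) by rewrite /A big_ord_recr.
have := wP j.+1 ltac:(lia); rewrite -/(Q _) -!natr1 => wj.
transitivity ((w j.+1 * (j%:R + 1)) * ((v%:R + 1 - t) * (A j * Q j.+1))); last by rewrite wj; ring.
ring.
Qed.

(** Both sides are polynomials in u of degree below p, equal to 0 at 0 and with equal differences
    between consecutive residues. [Phi i] interpolates 1^i + ... + s^i, and [tP] permits cancelling
    t - v. *)
Lemma hyp_sumE (R : idomainType) (p : nat) (w : nat -> R) (Phi : nat -> {poly R})
    (u t : R) :
  p \in [pchar R] -> (forall j, (0 < j < p)%N -> w j * j%:R = 1) ->
  (forall v, (v < p)%N -> v%:R != t) ->
  (forall i, (i < p.-1)%N -> (size (Phi i) <= i.+2)%N) ->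
  (forall i s, (i < p.-1)%N -> (s < p)%N ->
     (Phi i).[s%:R] = \sum_(x < s) x.+1%:R ^+ i) ->
  hyp_sum p w u t = \sum_(i < p.-1) t ^+ (p.-1.-1 - i) * (Phi i).[u].
Proof.
move=> pR wP tP szP PhiP; have p_gt1 := prime_gt1 (pcharf_prime pR).
pose P := hyp_sum p (polyC \o w) 'X t%:P -
  \sum_(i < p.-1) t ^+ (p.-1.-1 - i) *: Phi i.
have PE x : P.[x] = hyp_sum p w x t -
    \sum_(i < p.-1) t ^+ (p.-1.-1 - i) * (Phi i).[x].
  rewrite /P hornerD hornerN !horner_sum; congr (_ - _).
    apply: eq_bigr => j _; rewrite !hornerM /= hornerC !horner_prod.
    congr (_ * _ * _); apply: eq_bigr => i _; rewrite -polyC_natr !hornerE //.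
  by apply: eq_bigr => i _; rewrite hornerZ.
suff P0 : P = 0 by apply/eqP; rewrite -subr_eq0 -PE P0 horner0.
apply: (poly_eq0_ltp pR) => [|s].
  apply: leq_trans (size_polyD _ _) _; rewrite geq_max size_polyN; apply/andP; split.
    rewrite /hyp_sum big_nat.
    apply: (leq_trans (size_sum _ _ _)); apply/bigmax_leqP_seq => j _ jp.
    rewrite mulrAC; set c := _ * \prod_(_ <= i < _) _.
    have -> : c = (w j * \prod_(j.+1 <= i < p) (i%:R - t))%:P.
      rewrite polyCM rmorph_prod; congr (_ * _); apply: eq_bigr => i _.
      by rewrite rmorphB rmorph_nat.
    rewrite mul_polyC; apply: leq_trans (size_scale_leq _ _) _.
    under eq_bigr => i _ do rewrite -polyC_natr.
    by apply: leq_trans (size_prod_CsubX (fun i => i%:R) _) _; lia.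
  apply: (leq_trans (size_sum _ _ _)); apply/bigmax_leqP_seq => i _ _.
  apply: leq_trans (size_scale_leq _ _) _.
  by apply: leq_trans (szP _ _) _ => //; have := ltn_ord i; lia.
elim: s => [|s IH] sp.
  rewrite PE hyp_sum0 sub0r big1 ?oppr0 // => i _.
  by rewrite PhiP ?big_ord0 ?mulr0 //; lia.
have := IH (ltnW sp); rewrite !PE hyp_sum_diff ?tP // => /eqP.
rewrite subr_eq0 => /eqP ->; apply/eqP; rewrite subr_eq0 -big_split /=; apply/eqP.
apply: eq_bigr => i _; rewrite -mulrDr !PhiP //; last by lia.
by rewrite big_ord_recr.
Qed.

(** * Moments of the truncated logarithm *)


(* With [y] standing for ['X^p], this is the [{poly R}]-linear projection of
   [{poly R}] onto its subring of polynomials in [y]. *)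
Definition ptrace (R : nzRingType) (p : nat) (f : {poly R}) : {poly R} :=
  \poly_(k < size f) f`_(k * p).

(** The truncation of -log(1 - x); the term j = 0 vanishes because 0^-1 = 0. *)
Definition log_poly (R : unitRingType) (p : nat) : {poly R} :=
  \poly_(j < p) (j%:R^-1).

Lemma coef_ptrace (R : nzRingType) (p k : nat) (f : {poly R}) :
  (0 < p)%N -> (ptrace p f)`_k = f`_(k * p).
Proof.
move=> p_gt0; rewrite coef_poly; case: ltnP => // le_fk.
by rewrite nth_default // (leq_trans le_fk) // leq_pmulr.
Qed.

Lemma ptraceD (R : nzRingType) (p : nat) (f g : {poly R}) :
  (0 < p)%N -> ptrace p (f + g) = ptrace p f + ptrace p g.
Proof. by move=> p0; apply/polyP => k; rewrite coefD !coef_ptrace // coefD. Qed.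

Lemma ptraceZ (R : nzRingType) (p : nat) (c : R) (f : {poly R}) :
  (0 < p)%N -> ptrace p (c *: f) = c *: ptrace p f.
Proof. by move=> p0; apply/polyP => k; rewrite coefZ !coef_ptrace // coefZ. Qed.

Lemma ptrace_sum (R : nzRingType) (p : nat) (I : Type) (r : seq I) (P : pred I)
    (F : I -> {poly R}) : (0 < p)%N ->
  ptrace p (\sum_(i <- r | P i) F i) = \sum_(i <- r | P i) ptrace p (F i).
Proof.
move=> p0; apply/polyP => k; rewrite coef_ptrace // !coef_sum.
by apply: eq_bigr => i _; rewrite coef_ptrace.
Qed.

Lemma ptrace_mulXn (R : nzRingType) (p : nat) (f : {poly R}) :
  (0 < p)%N -> ptrace p (f * 'X^p) = ptrace p f * 'X.
Proof.
move=> p0; apply/polyP => k; rewrite coef_ptrace // coefMXn coefMX coef_ptrace //.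
case: k => [|k]; first by rewrite p0.
by rewrite mulSn ltnNge leq_addr addKn.
Qed.

Lemma ptrace_comp_Xn (R : comNzRingType) (p : nat) (f h : {poly R}) :
  (0 < p)%N -> ptrace p (f * (h \Po 'X^p)) = ptrace p f * h.
Proof.
move=> p0; elim/poly_ind: h f => [|h c IH] f.
  rewrite comp_poly0 !mulr0; apply/polyP => k.
  by rewrite coef_ptrace // !coef0.
rewrite comp_polyD comp_polyM comp_polyX comp_polyC !mulrDr ptraceD // mulrA.
by rewrite ptrace_mulXn // IH -mulrA ![_ * c%:P]mulrC !mul_polyC ptraceZ.
Qed.

(** The coefficient of 'X^(kp) in 'X f' is kp times that of f. This is what makes integration by
    parts possible. *)
Lemma ptrace_deriv (R : comNzRingType) (p : nat) (f : {poly R}) :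
  p \in [pchar R] -> ptrace p ('X * f^`()) = 0.
Proof.
move=> pR; have p0 := prime_gt0 (pcharf_prime pR).
apply/polyP => k; rewrite coef_ptrace // coefXM coef0; case: eqP => // kp.
rewrite coef_deriv prednK; last by lia.
by rewrite -mulr_natr natrM (pcharf0 pR) !mulr0.
Qed.

(** 'X L' is the geometric sum 'X + ... + 'X^(p-1), which telescopes against 1 - 'X. *)
Lemma log_poly_deriv (K : fieldType) (p : nat) : p \in [pchar K] ->
  (1 - 'X) * ('X * (log_poly K p)^`()) = 'X - 'X^p.
Proof.
move=> pK; have p1 := prime_gt1 (pcharf_prime pK).
have -> : 'X * (log_poly K p)^`() = \sum_(1 <= j < p) 'X^j.
  apply/polyP => k; rewrite coefXM coef_deriv coef_poly coef_sum.
  under eq_bigr => j _ do rewrite coefXn.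
  case: k => [|k] /=.
    by rewrite big_add1 big1.
  case: ltnP => kp.
    rewrite (bigD1_seq k.+1) ?iota_uniq ?mem_index_iota //= eqxx big1 ?addr0.
      by rewrite -[_ *+ k.+1]mulr_natr mulVf // (natr_neq0_ltp pK).
    by move=> j /negbTE; rewrite eq_sym => ->.
  rewrite mul0rn big_nat big1 // => j jp.
  by rewrite (_ : (k.+1 == j) = false) //; lia.
rewrite mulr_sumr -opprB -[RHS]opprB -[in RHS](expr1 'X).
rewrite -(telescope_sumr (fun j => 'X^j : {poly K})); last by lia.
rewrite -sumrN; apply: eq_bigr => j _.
by rewrite exprS; ring.
Qed.

Definition log_moment (K : fieldType) (p n i : nat) : {poly K} :=
  ptrace p ('X^i * log_poly K p ^+ n).

(** The trace of 'X f' vanishes for f = (1 - 'X) 'X^i L^n. For n = 0 the meaningless index [n.-1] is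
    multiplied by 0. *)
Lemma log_moment_rec (K : fieldType) (p n i : nat) : p \in [pchar K] ->
  i%:R * log_moment K p n i - n%:R * 'X * log_moment K p n.-1 i =
  i.+1%:R * log_moment K p n i.+1 - n%:R * log_moment K p n.-1 i.+1.
Proof.
move=> pK; have p0 := prime_gt0 (pcharf_prime pK).
pose L := log_poly K p.
pose f : {poly K} := (1 - 'X) * 'X^i * L ^+ n.
pose T k j : {poly K} := 'X^j * L ^+ k.
have D : 'X * f^`() =
    (i%:R : K) *: T n i - (i.+1%:R : K) *: T n i.+1 +
    ((n%:R : K) *: T n.-1 i.+1 - (n%:R : K) *: (T n.-1 i * 'X^p)).
  rewrite /f /T; have XD j : 'X * ('X^j)^`() = j%:R * 'X^j :> {poly K}.
    by rewrite derivXn mulrnAr -mulr_natl; case: j => [|j]; rewrite ?mul0r ?mulr0 // exprS; ring.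
  have -> : (1 - 'X) * 'X^i = 'X^i - 'X^(i.+1) :> {poly K} by rewrite exprS; ring.
  rewrite derivM derivB (deriv_exp L) -[_ * _ *+ n]mulr_natl -!mul_polyC !polyC_natr.
  transitivity (('X * ('X^i)^`() - 'X * ('X^(i.+1))^`()) * L ^+ n +
    n%:R * ((1 - 'X) * ('X * L^`())) * 'X^i * L ^+ n.-1); first by rewrite exprS; ring.
  by rewrite !XD log_poly_deriv // exprS; ring.
have := ptrace_deriv f pK.
rewrite D -!scaleNr !ptraceD // !ptraceZ // ptrace_mulXn // /T -!/(log_moment _ _ _ _).
rewrite !scaleNr -!mul_polyC !polyC_natr => E.
apply/eqP; rewrite -subr_eq0 -E; apply/eqP; ring.
Qed.

Lemma log_momentS (K : fieldType) (p n : nat) : p \in [pchar K] ->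
  log_moment K p n.+1 0 = \sum_(1 <= j < p) j%:R^-1 *: log_moment K p n j.
Proof.
move=> pK; have p0 := prime_gt0 (pcharf_prime pK).
rewrite /log_moment expr0 mul1r exprS {1}/log_poly poly_def mulr_suml ptrace_sum //.
rewrite -(big_mkord xpredT (fun j => ptrace p (j%:R^-1 *: 'X^j * log_poly K p ^+ n))).
rewrite big_ltn // invr0 scale0r mul0r; have -> : ptrace p 0 = 0 :> {poly K}.
  by apply/polyP => k; rewrite coef_ptrace // !coef0.
by rewrite add0r; apply: eq_bigr => j _; rewrite -scalerAl ptraceZ.
Qed.

(** * Generating polynomials in t and their differential equation *)

Definition eq_coef_lt (R : nzRingType) (N : nat) (f g : {poly R}) :=
  forall n, (n < N)%N -> f`_n = g`_n.

Lemma eq_coef_ltMl (R : nzRingType) (N : nat) (h f g : {poly R}) :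
  eq_coef_lt N f g -> eq_coef_lt N (h * f) (h * g).
Proof.
move=> fg n nN; rewrite !coefM; apply: eq_bigr => i _.
by rewrite fg // (leq_ltn_trans (leq_subr _ _)).
Qed.

(** In {poly {poly K}} the outer variable 'X is t and the inner one 'X%:P is y, so u = ty is 'X *
    'X%:P. The cut at n < p keeps n! invertible. *)
Definition exp_moment (K : fieldType) (p i : nat) : {poly {poly K}} :=
  \poly_(n < p) (n`!%:R^-1 *: log_moment K p n i).

Lemma fact_neq0 (K : fieldType) (p n : nat) : p \in [pchar K] -> (n < p)%N ->
  n`!%:R != 0 :> K.
Proof.
move=> pK; elim: n => [|n IH] np; first by rewrite oner_eq0.
rewrite factS natrM mulf_neq0 ?IH //; last exact: ltnW.
exact: (natr_neq0_ltp pK).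
Qed.

Lemma exp_moment_rec (K : fieldType) (p i : nat) : p \in [pchar K] ->
  eq_coef_lt p ((i%:R - 'X * 'X%:P) * exp_moment K p i)
               ((i.+1%:R - 'X) * exp_moment K p i.+1).
Proof.
move=> pK n np; rewrite !mulrBl -!mulrA ['X%:P * _]mulrC !coefB ![('X * _)`_n]coefXM.
rewrite -!polyC_natr !coefCM coefMC !coef_poly np.
case: n np => [|n] np /=.
  rewrite fact0 invr1 !scale1r !subr0.
  have := @log_moment_rec K p 0 i pK.
  by rewrite !mul0r !subr0 !polyC_natr => E; exact: E.
rewrite (ltnW np).
have n0 := @natr_neq0_ltp K p n.+1 pK ltac:(lia).
have -> : n`!%:R^-1 = n.+1`!%:R^-1 * n.+1%:R :> K.
  by rewrite factS natrM invfM mulrAC mulVf ?mul1r.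
rewrite -![(_ * _) *: _]scalerA -!scalerAl -!scalerAr -!scalerBr.
congr (_ *: _); rewrite -!mul_polyC !polyC_natr.
by have := @log_moment_rec K p n.+1 i pK => /= <-; ring.
Qed.

(** Iterating the two-term recursion links moment j to moment 0 by a ratio of rising products,
    written without denominators. *)
Lemma exp_moment_prod (K : fieldType) (p j : nat) : p \in [pchar K] ->
  eq_coef_lt p (\prod_(1 <= i < j.+1) (i%:R - 'X) * exp_moment K p j)
    (\prod_(i < j) (i%:R - 'X * 'X%:P) * exp_moment K p 0).
Proof.
move=> pK; elim: j => [|j IH]; first by rewrite big_nil big_ord0 !mul1r.
rewrite big_nat_recr //= big_ord_recr /= -!mulrA => n np.
rewrite -(eq_coef_ltMl _ (exp_moment_rec j pK) np).
by rewrite mulrCA [in RHS]mulrCA (eq_coef_ltMl _ IH np).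
Qed.

(** d/dt e^(tL) = L e^(tL); differentiating costs one order of precision. *)
Lemma deriv_exp_moment (K : fieldType) (p : nat) : p \in [pchar K] ->
  eq_coef_lt p.-1 (exp_moment K p 0)^`()
    (\sum_(1 <= j < p) (j%:R^-1)%:P%:P * exp_moment K p j).
Proof.
move=> pK n np; have np1 : (n.+1 < p)%N by lia.
rewrite coef_deriv coef_sum coef_poly np1 log_momentS //.
transitivity (n`!%:R^-1 *: \sum_(1 <= j < p) j%:R^-1 *: log_moment K p n j).
  rewrite -scaler_nat scalerA factS natrM invfM mulrA divff ?mul1r //.
  exact: natr_neq0_ltp pK _.
rewrite scaler_sumr; apply: eq_bigr => j _.
by rewrite coefCM coef_poly (ltnW np1) mul_polyC !scalerA mulrC.
Qed.

Definition inv_cst (K : fieldType) (j : nat) : {poly {poly K}} := (j%:R^-1)%:P%:P.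

Lemma inv_cstP (K : fieldType) (p j : nat) : p \in [pchar K] -> (0 < j < p)%N ->
  inv_cst K j * j%:R = 1.
Proof.
by move=> pK jp; rewrite -!polyC_natr -!polyCM mulVf // (natr_neq0_ltp pK).
Qed.

(** Modulo t^(p-1), multiplying by the product of all i - t, equal to t^(p-1) - 1, only changes the
    sign. The factors with i <= j turn moment j into moment 0, and those with i > j remain in
    [hyp_sum]. *)
Lemma exp_moment_ode (K : fieldType) (p : nat) : p \in [pchar K] ->
  eq_coef_lt p.-1 (- (exp_moment K p 0)^`())
    (hyp_sum p (inv_cst K) ('X * 'X%:P) 'X * exp_moment K p 0).
Proof.
move=> pK n np.
have pR : p \in [pchar {poly {poly K}}] by rewrite !pchar_poly.
rewrite coefN (deriv_exp_moment pK np) /hyp_sum mulr_suml.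
transitivity (\sum_(1 <= j < p) (('X^(p.-1) - 1) *
   (inv_cst K j * exp_moment K p j)))`_n.
  by rewrite -mulr_sumr mulrBl mul1r coefB coefXnM np sub0r.
rewrite !coef_sum; apply: eq_big_nat => j jp.
rewrite -prod_natr_sub // (@big_cat_nat _ _ _ j.+1) /=; [|lia|lia].
have np' : (n < p)%N by lia.
have E := eq_coef_ltMl (inv_cst K j * \prod_(j.+1 <= i < p) (i%:R - 'X))
  (exp_moment_prod j pK) np'.
transitivity ((inv_cst K j * \prod_(j.+1 <= i < p) (i%:R - 'X) *
  (\prod_(1 <= i < j.+1) (i%:R - 'X) * exp_moment K p j))`_n).
  by congr (nth 0 (polyseq _) n); ring.
by rewrite E; congr (nth 0 (polyseq _) n); ring.
Qed.

(** * Coefficients of S in terms of Bernoulli numbers *)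

(** The polynomial with values 1^i + ... + s^i: [faulhaber] covers 0^i to (s - 1)^i, so s^i is added
    and 0^i, which is 1 for i = 0 only, is removed. *)
Definition faulhaber_poly (K : fieldType) (b : nat -> K) (i : nat) :
    {poly {poly {poly K}}} :=
  (inv_cst K i.+1)%:P * faulhaber (polyC \o (polyC \o (polyC \o b))) i 'X +
  'X^i - (i == 0)%:R.

Lemma horner_faulhaber_poly (K : fieldType) (b : nat -> K) (i : nat) u :
  (faulhaber_poly b i).[u] =
    inv_cst K i.+1 * faulhaber (polyC \o (polyC \o b)) i u + u ^+ i - (i == 0)%:R.
Proof.
by rewrite /faulhaber_poly !hornerE horner_faulhaber hornerX -polyC_natr hornerC.
Qed.

Lemma coef_XCX_exp (K : fieldType) (j d : nat) :
  (('X * 'X%:P : {poly {poly K}}) ^+ j)`_d = if d == j then 'X^j else 0.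
Proof.
by rewrite exprMn -rmorphXn coefMC coefXn; case: eqP; rewrite ?mul1r ?mul0r.
Qed.

Lemma coef_faulhaber_poly (K : fieldType) (b : nat -> K) (i d : nat) :
  (faulhaber (polyC \o (polyC \o b)) i ('X * 'X%:P))`_d =
  if (0 < d <= i.+1)%N then ('C(i.+1, d)%:R * b (i.+1 - d)%N) *: 'X^d else 0.
Proof.
have E k : ('C(i.+1, k)%:R * (polyC \o (polyC \o b)) k * ('X * 'X%:P) ^+ (i.+1 - k))`_d =
    if d == (i.+1 - k)%N then ('C(i.+1, k)%:R * b k) *: 'X^d else 0.
  rewrite /= -!polyC_natr -!polyCM coefCM coef_XCX_exp mul_polyC.
  by case: eqP => [->|_] //; rewrite scaler0.
rewrite /faulhaber coef_sum; under eq_bigr => k _ do rewrite E.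
case: ifP => d_i.
  have lt_k : (i.+1 - d < i.+1)%N by lia.
  rewrite (bigD1 (Ordinal lt_k)) //= big1 ?addr0 => [|k].
    by rewrite subKn ?eqxx ?bin_sub //; lia.
  rewrite -val_eqE /= => k_d; have := ltn_ord k => lt_ki.
  by rewrite (_ : (d == i.+1 - k)%N = false) //; lia.
rewrite big1 // => k _; have := ltn_ord k => lt_ki.
by rewrite (_ : (d == i.+1 - k)%N = false) //; lia.
Qed.

(** In the sum over i given by [hyp_sumE], the monomial u^d of the i-th polynomial meets t^(a-1)
    exactly when d = i + 1 - (p - a), so the Bernoulli index i + 1 - d is always p - a. *)
Lemma coef_hyp_sum (K : fieldType) (p : nat) (b : nat -> K) (a : nat) :
  p \in [pchar K] -> bern_rec b p.-2 -> (0 < a < p.-1)%N ->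
  (hyp_sum p (inv_cst K) ('X * 'X%:P) 'X)`_a.-1 =
  \sum_(c < a.-1) (((p - a + c.+1)%:R^-1 * 'C(p - a + c.+1, p - a)%:R * b (p - a)%N)
     *: 'X^(c.+1)).
Proof.
move=> pK bP a_p; have p_gt1 := prime_gt1 (pcharf_prime pK).
have pR : p \in [pchar {poly {poly K}}] by rewrite !pchar_poly.
have bP1 : bern_rec (polyC \o (polyC \o b) : nat -> {poly {poly K}}) p.-2.
  by do 2 apply: (rmorph_bern_rec polyC).
rewrite (@hyp_sumE _ p _ (faulhaber_poly b)) //; first last.
- move=> i s ip sp; rewrite horner_faulhaber_poly faulhaber_sum; last first.
    by move=> k ki; apply: bP1; lia.
  rewrite mulrA (inv_cstP pK) ?mul1r; last by lia.
  have -> : \sum_(x < s) x%:R ^+ i + s%:R ^+ i = \sum_(x < s.+1) x%:R ^+ i :> {poly {poly K}}.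
    by rewrite big_ord_recr.
  by rewrite big_ord_recl /= expr0n addrC addrA addNr add0r.
- move=> i ip; apply: leq_trans (size_polyD _ _) _; rewrite geq_max size_polyN.
  apply/andP; split; last by rewrite -polyC_natr; apply: leq_trans (size_polyC_leq1 _) _.
  apply: leq_trans (size_polyD _ _) _; rewrite geq_max size_polyXn leqnSn andbT.
  by rewrite mul_polyC; apply: leq_trans (size_scale_leq _ _) _; apply: size_faulhaber.
- move=> v vp; apply/eqP => /(congr1 (fun q : {poly {poly K}} => q`_1)).
  by rewrite -polyC_natr coefC coefX => /esym/eqP; rewrite oner_eq0.
- by move=> j; apply: inv_cstP pK.
rewrite coef_sum -(big_mkord xpredT (fun i => ('X^(p.-2 - i) *
   (faulhaber_poly b i).['X * 'X%:P])`_a.-1)).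
have E i : (i < p.-1)%N -> ('X^(p.-2 - i) * (faulhaber_poly b i).['X * 'X%:P])`_a.-1 =
    if (p - a <= i)%N then (i.+1%:R^-1 * 'C(i.+1, p - a)%:R * b (p - a)%N)
      *: 'X^(i.+1 - (p - a)) else 0.
  move=> ip; rewrite coefXnM; case: ltnP => ai.
    by rewrite ifF //; lia.
  rewrite horner_faulhaber_poly coefB coefD coefCM mul_polyC coef_faulhaber_poly.
  rewrite coef_XCX_exp -polyC_natr coefC.
  (* The terms u^i and 0^i would reach t^(a-1) only for a = p - 1, which is excluded. *)
  rewrite (_ : (a.-1 - (p.-2 - i) == i)%N = false) ?addr0; last by lia.
  have -> : (if (a.-1 - (p.-2 - i))%N == 0%N then (i == 0%N)%:R else 0) = 0 :> {poly K}.
    by case: eqP => // ai0; rewrite (_ : (i == 0)%N = false) //; lia.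
  rewrite subr0; case: ifP => ai1; last by rewrite scaler0 ifF //; lia.
  have dE : (a.-1 - (p.-2 - i) = i.+1 - (p - a))%N by lia.
  rewrite dE subKn ?bin_sub ?ifT ?scalerA ?mulrA //; lia.
rewrite (eq_big_nat _ _ (F2 := fun i => if (p - a <= i)%N then
   (i.+1%:R^-1 * 'C(i.+1, p - a)%:R * b (p - a)%N) *: 'X^(i.+1 - (p - a)) else 0)); last first.
  by move=> i /andP[_]; apply: E.
rewrite (@big_cat_nat _ _ _ (p - a)) /=; [|lia|lia].
rewrite big_nat big1 ?add0r => [|i ip]; last by rewrite ifF //; lia.
rewrite -[X in \sum_(X <= _ < _) _]add0n big_addn big_mkord.
have -> : (p.-1 - (p - a) = a.-1)%N by lia.
apply: eq_bigr => c _; rewrite ifT ?leq_addl //.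
have -> : ((c + (p - a)).+1 = p - a + c.+1)%N by lia.
by rewrite addKn.
Qed.

(** Modulo p the numerator factors p - a + i, 1 <= i <= c, become -(a - i). *)
Lemma bin_mod_prime (K : fieldType) (p a c : nat) : p \in [pchar K] ->
  (c < a < p)%N -> 'C(p - a + c, c)%:R = (-1) ^+ c * 'C(a.-1, c)%:R :> K.
Proof.
move=> pK; elim: c => [|c IH] cap; first by rewrite !bin0 mulr1.
have c0 := @natr_neq0_ltp K p c.+1 pK ltac:(lia).
apply: (mulfI c0); rewrite -natrM addnS -mul_bin_diag natrM /= IH; last by lia.
rewrite exprS [in RHS]mulrCA -[_%:R * _ in RHS]natrM mul_bin_left natrM.
have -> : (p - a + c).+1%:R = - (a.-1 - c)%:R :> K.
  apply/eqP; rewrite -subr_eq0 opprK -natrD.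
  by rewrite (_ : ((p - a + c).+1 + (a.-1 - c) = p)%N) ?(pcharf0 pK) //; lia.
ring.
Qed.

Lemma bin_mod_prime_div (K : fieldType) (p a c : nat) : p \in [pchar K] ->
  (c.+1 < a < p)%N -> (p - a + c.+1)%:R^-1 * 'C(p - a + c.+1, p - a)%:R =
   (-1) ^+ c * a%:R^-1 * 'C(a, c.+1)%:R :> K.
Proof.
move=> pK cap.
have -> : ('C(p - a + c.+1, p - a) = 'C(p - a + c.+1, c.+1))%N.
  by rewrite -bin_sub ?addKn //; lia.
have c0 := @natr_neq0_ltp K p c.+1 pK ltac:(lia).
have a0 := @natr_neq0_ltp K p a pK ltac:(lia).
have n0 := @natr_neq0_ltp K p (p - a + c.+1) pK ltac:(lia).
apply: (mulfI c0); rewrite mulrCA [in RHS]mulrCA -!natrM.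
have -> : (c.+1 * 'C(a, c.+1) = a * 'C(a.-1, c))%N by rewrite mul_bin_diag.
rewrite -mul_bin_diag !natrM addnS /= (bin_mod_prime pK); last by lia.
by rewrite addnS in n0; rewrite mulKf // -mulrA mulKf.
Qed.

(** Divided by (1 - y)^a this is (1 - y)^(-a) - (y / (1 - y))^a - 1, the source of the two binomials
    in the theorem. *)
Definition beta_poly (R : nzRingType) (a : nat) : {poly R} := 1 - 'X^a - (1 - 'X) ^+ a.

(** For odd a the terms of degree 0 and a cancel in the binomial expansion. *)
Lemma beta_polyE (R : comNzRingType) (a : nat) : odd a ->
  beta_poly R a = \sum_(c < a.-1) ((-1) ^+ c * 'C(a, c.+1)%:R) *: 'X^(c.+1).
Proof.
case: a => // a odd_a.
pose F i : {poly R} := ((-1) ^+ i * 'C(a.+1, i)%:R) *: 'X^i.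
have E : (1 - 'X) ^+ a.+1 = \sum_(i < a.+2) F i.
  rewrite exprBn; apply: eq_bigr => i _; rewrite expr1n mulr1 /F -mul_polyC.
  by rewrite polyCM rmorphXn /= polyCN polyC_natr -[_ *+ _]mulr_natr; ring.
have F0 : F 0%N = 1 by rewrite /F expr0 bin0 mul1r scale1r.
have Fa : F a.+1 = - 'X^(a.+1).
  by rewrite /F -signr_odd odd_a binn mulr1 scaleN1r.
rewrite /beta_poly E big_ord_recl big_ord_recr /= F0 -[bump 0 a]/(a.+1) Fa.
have -> : \sum_(c < a) ((-1) ^+ c * 'C(a.+1, c.+1)%:R) *: 'X^(c.+1) =
    - \sum_(c < a) F (bump 0 c).
  rewrite -sumrN; apply: eq_bigr => c _.
  by rewrite -[bump 0 c]/(c.+1) /F [(-1) ^+ c.+1]exprS mulN1r mulNr scaleNr opprK.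
ring.
Qed.

(** The component at p of the Bernoulli number b_a, extended by 0 so that sums over all a reduce to
    odd a >= 3. *)
Definition beta_coef (K : fieldType) (p : nat) (b : nat -> K) (a : nat) : K :=
  if (3 <= a)%N && odd a then - b (p - a)%N / a%:R else 0.

(** For odd a >= 3 the coefficients agree termwise. For even a the index p - a is odd and above 1,
    so [b] vanishes there; for a = 1 the sum is empty. *)
Lemma coef_hyp_sum_beta (K : fieldType) (p : nat) (b : nat -> K) (a : nat) :
  p \in [pchar K] -> bern_rec b p.-2 ->
  (forall k, (1 < k <= p.-2)%N -> odd k -> b k = 0) ->
  odd p -> (0 < a < p - 2)%N ->
  - (hyp_sum p (inv_cst K) ('X * 'X%:P) 'X)`_a.-1 =
    beta_coef p b a *: beta_poly K a.
Proof.
move=> pK bP b_odd p_odd a_p; rewrite (coef_hyp_sum pK bP); last by lia.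
rewrite /beta_coef; case: ifP => [/andP[a3 a_odd]|a_not].
  rewrite beta_polyE // scaler_sumr -sumrN; apply: eq_bigr => c _.
  have lt_c := ltn_ord c; rewrite (bin_mod_prime_div pK); last by lia.
  rewrite scalerA -scaleNr; congr (_ *: _); ring.
rewrite scale0r big1 ?oppr0 // => c _; have lt_c := ltn_ord c.
by rewrite b_odd ?mulr0 ?scale0r //; lia.
Qed.

Definition exp_coef (K : fieldType) (p n : nat) : {poly K} :=
  n`!%:R^-1 *: ptrace p (log_poly K p ^+ n).

(** The coefficient of t^(n-1) in the differential equation, with S replaced by its evaluation. *)
Lemma exp_coef_ode (K : fieldType) (p : nat) (b : nat -> K) (n : nat) :
  p \in [pchar K] -> bern_rec b p.-2 ->
  (forall k, (1 < k <= p.-2)%N -> odd k -> b k = 0) ->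
  odd p -> (n < p - 2)%N ->
  n%:R * exp_coef K p n =
    \sum_(1 <= a < n.+1) beta_coef p b a *: beta_poly K a * exp_coef K p (n - a)%N.
Proof.
move=> pK bP b_odd p_odd; case: n => [|n] n_p; first by rewrite mul0r big_geq.
have JE k : (k < p)%N -> (exp_moment K p 0)`_k = exp_coef K p k.
  by move=> kp; rewrite coef_poly kp /exp_coef /log_moment expr0 mul1r.
have := @exp_moment_ode K p pK n ltac:(lia).
rewrite coefN coef_deriv JE; last by lia.
move=> /eqP; rewrite eqr_oppLR => /eqP; rewrite mulr_natl => ->.
rewrite coefM -sumrN big_add1 big_mkord; apply: eq_bigr => c _.
have lt_c := ltn_ord c.
rewrite -(coef_hyp_sum_beta (a := c.+1) pK bP b_odd p_odd) /=; last by lia.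
by rewrite JE ?mulNr //; lia.
Qed.

(** * Passing from t to t / (1 - y) *)


Lemma coef_prod_poly (R : comNzRingType) (n B N : nat) (c : 'I_n -> nat -> R) :
  (\prod_(i < n) \poly_(l < B) c i l)`_N =
  \sum_(f : {ffun 'I_n -> 'I_B} | (\sum_i f i == N)%N) \prod_i c i (f i).
Proof.
under eq_bigr => i _ do rewrite poly_def.
rewrite bigA_distr_bigA coef_sum [RHS]big_mkcond; apply: eq_bigr => f _ /=.
rewrite scaler_prod -expr_sum coefZ coefXn eq_sym.
by case: eqP; rewrite ?mulr1 ?mulr0.
Qed.

Lemma eq_coef_ltX (R : comNzRingType) (N n : nat) (f g : {poly R}) :
  eq_coef_lt N f g -> eq_coef_lt N (f ^+ n) (g ^+ n).
Proof.
move=> fg; elim: n => [|n IH] k kN; first by rewrite !expr0.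
by rewrite !exprS (eq_coef_ltMl _ IH kN) mulrC (eq_coef_ltMl _ fg kN) mulrC.
Qed.

Lemma coef_mul_comp_Xn (R : comNzRingType) (p l : nat) (f h : {poly R}) :
  (0 < p)%N -> (size f <= p)%N ->
  (f * (h \Po 'X^p))`_l = f`_(l %% p) * h`_(l %/ p).
Proof.
move=> p0 sf; elim/poly_ind: h l => [|h c IH] l.
  by rewrite comp_poly0 mulr0 !coef0 mulr0.
rewrite comp_polyD comp_polyM comp_polyX comp_polyC mulrDr mulrA coefD coefMXn.
rewrite coefMC coefD coefMX coefC; case: ltnP => lp.
  by rewrite divn_small // modn_small //= !add0r.
have -> : f`_l = 0 by rewrite nth_default // (leq_trans sf).
rewrite mul0r addr0 IH -{3 4 5 6}(subnK lp) modnDr divnDr ?dvdnn // divnn p0 addn1.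
by rewrite addr0.
Qed.

Definition geom (R : nzRingType) (M : nat) : {poly R} := \poly_(q < M.+1) 1.

(** Since 1 / (pq + j) = 1 / j in characteristic p, the series of all x^l / l is L / (1 - y).
    Indices divisible by p may stay, as their inverse is 0. *)
Lemma sum_inv_prod (K : fieldType) (p n m : nat) : p \in [pchar K] ->
  \sum_(f : {ffun 'I_n -> 'I_(m * p).+1} | (\sum_i f i == m * p)%N)
    \prod_i (f i)%:R^-1 = (ptrace p (log_poly K p ^+ n) * geom K m ^+ n)`_m.
Proof.
move=> pK; have p0 := prime_gt0 (pcharf_prime pK).
rewrite -(coef_prod_poly (m * p).+1 (m * p) (fun _ l => l%:R^-1)).
rewrite prodr_const card_ord -ptrace_comp_Xn // coef_ptrace // rmorphXn -exprMn /=.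
apply: (@eq_coef_ltX _ (m * p).+1) => // l lmp.
rewrite coef_mul_comp_Xn ?size_poly // !coef_poly lmp ltn_mod p0 ltnS.
rewrite (_ : (l %/ p <= m)%N) ?mulr1; last first.
  by have := leq_div2r p (lmp : (l <= m * p)%N); rewrite mulnK.
by congr (_^-1); rewrite (GRing.natr_mod_pchar pK).
Qed.

Lemma mul_geom (R : comNzRingType) (M : nat) :
  eq_coef_lt M.+1 ((1 - 'X) * geom R M) 1.
Proof.
move=> k kM; rewrite mulrBl mul1r coefB coefXM !coef_poly kM coef1.
by case: k kM => [|k] kM /=; rewrite ?subr0 // (ltnW kM) subrr.
Qed.

Lemma coef_geomX (R : comNzRingType) (M a k : nat) : (k <= M)%N ->
  (geom R M ^+ a.+1)`_k = 'C(k + a, a)%:R.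
Proof.
elim: a k => [|a IHa] k kM; first by rewrite expr1 coef_poly ltnS kM bin0.
elim: k kM => [|k IHk] kM.
  by rewrite exprS coef0M IHa // coef_poly /= mul1r !add0n !binn.
have := eq_coef_ltMl (geom R M ^+ a.+1) (@mul_geom R M) (_ : (k.+1 < M.+1)%N).
move=> /(_ kM).
rewrite mulr1 IHa // mulrCA -exprSr mulrBl mul1r coefB coefXM /= IHk ?(ltnW kM) //.
move=> /eqP; rewrite subr_eq => /eqP ->.
by rewrite -natrD [(k.+1 + a.+1)%N]addSn binS addnC addSnnS.
Qed.

(** For k > 0 the coefficient is C(k+a-1, a-1) - C(k-1, a-1), rewritten by absorption. For k = 0 the
    left side is 1 - 1 and the right side contains 0^-1 = 0. *)
Lemma coef_beta_geom (K : fieldType) (p M a k : nat) : p \in [pchar K] ->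
  (0 < a)%N -> (k <= M)%N -> (k < p)%N ->
  (beta_poly K a * geom K M ^+ a)`_k =
    a%:R * (k%:R^-1 * ('C(k + a - 1, a)%:R - 'C(k, a)%:R)).
Proof.
move=> pK a0 kM kp; rewrite /beta_poly !mulrBl mul1r !coefB -[(1 - 'X) ^+ a * _]exprMn.
rewrite (eq_coef_ltX a (@mul_geom _ _)) // expr1n coef1 coefXnM.
case: a a0 => // a _; case: k kM kp => [|k] kM kp.
  by rewrite coef_geomX // invr0 mul0r mulr0 add0n binn /= subr0 subrr.
have k0 := @natr_neq0_ltp K p k.+1 pK ltac:(lia).
rewrite subr0; apply: (mulfI k0); rewrite mulrCA mulVKf // !mulrBr.
rewrite coef_geomX // -!natrM.
have -> : (a.+1 * 'C(k.+1 + a.+1 - 1, a.+1) = k.+1 * 'C(k.+1 + a, a))%N.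
  by rewrite addnS subn1 mul_bin_left addnK.
congr (_ - _); rewrite -mul_bin_diag natrM; congr (_ * _).
case: ltnP => ka; first by rewrite bin_small.
by rewrite coef_geomX ?subSS ?subnK //; lia.
Qed.

(** The substitution t -> t / (1 - y): [exp_coef_ode] is multiplied by (1 - y)^(-n), split as (1 -
    y)^(-a) times (1 - y)^(-(n-a)). *)
Lemma exp_coef_geom_rec (K : fieldType) (p M n m : nat) (b : nat -> K) :
  p \in [pchar K] -> bern_rec b p.-2 ->
  (forall k, (1 < k <= p.-2)%N -> odd k -> b k = 0) ->
  odd p -> (n < p - 2)%N -> (m <= M)%N -> (m < p)%N ->
  let G n m := (exp_coef K p n * geom K M ^+ n)`_m in
  n%:R * G n m = \sum_(a < n.+1) \sum_(k < m.+1)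
     a%:R * (k%:R^-1 * (('C(k + a - 1, a)%:R - 'C(k, a)%:R) * beta_coef p b a))
       * G (n - a)%N (m - k)%N.
Proof.
move=> pK bP b_odd p_odd n_p mM mp /=.
rewrite -coefCM polyC_natr mulrA (exp_coef_ode pK bP) // mulr_suml coef_sum.
rewrite big_add1 big_mkord [RHS]big_ord_recl /= [X in X + _]big1 ?add0r; last first.
  by move=> k _; rewrite !mul0r.
apply: eq_bigr => a _; have lt_a := ltn_ord a; rewrite -[bump 0 a]/(a.+1).
have -> : geom K M ^+ n = geom K M ^+ a.+1 * geom K M ^+ (n - a.+1).
  by rewrite -exprD subnKC.
rewrite -!(scalerAl (beta_coef p b a.+1)) mulrACA coefZ coefM mulr_sumr; apply: eq_bigr => k _.
have lt_k := ltn_ord k.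
by rewrite (coef_beta_geom (p := p)) //; [ring|lia|lia].
Qed.

(** * Sums over compositions *)


Lemma sum_triangle (V : nmodType) (m : nat) (f : nat -> nat -> V) :
  \sum_(k < m.+1) \sum_(j < (m - k).+1) f k j =
  \sum_(j < m.+1) \sum_(k < (m - j).+1) f k j.
Proof.
have E (g : nat -> nat -> V) (k : nat) : (k < m.+1)%N -> \sum_(j < (m - k).+1) g k j =
    \sum_(j < m.+1 | (k + j < m.+1)%N) g k j.
  move=> km; rewrite (big_ord_widen_cond m.+1 xpredT (g k)); last by lia.
  by apply: eq_bigl => j /=; apply/idP/idP; lia.
under eq_bigr => k _ do rewrite E //.
under [RHS]eq_bigr => k _ do rewrite (E (fun j k => f k j)) //.
rewrite (exchange_big_dep xpredT) //=; apply: eq_bigr => j _.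
by apply: eq_bigl => k; rewrite addnC.
Qed.

Definition ffun_rcons (T : Type) (l : nat) (g : {ffun 'I_l -> T}) (x : T) :
    {ffun 'I_l.+1 -> T} :=
  [ffun i => if unlift ord_max i is Some j then g j else x].

Lemma ffun_rcons_widen (T : Type) (l : nat) (g : {ffun 'I_l -> T}) (x : T) j :
  ffun_rcons g x (widen_ord (leqnSn l) j) = g j.
Proof.
rewrite ffunE (_ : widen_ord _ j = lift ord_max j) ?liftK //.
by apply: val_inj; rewrite /= /bump leqNgt ltn_ord.
Qed.

Lemma ffun_rcons_max (T : Type) (l : nat) (g : {ffun 'I_l -> T}) (x : T) :
  ffun_rcons g x ord_max = x.
Proof. by rewrite ffunE unlift_none. Qed.

Lemma sum_ffun_rcons (V : nmodType) (T : finType) (l : nat)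
    (F : {ffun 'I_l.+1 -> T} -> V) :
  \sum_f F f = \sum_(x : T) \sum_(g : {ffun 'I_l -> T}) F (ffun_rcons g x).
Proof.
rewrite exchange_big pair_big /=.
rewrite (reindex (fun gx => ffun_rcons gx.1 gx.2)) //=.
exists (fun f => ([ffun j => f (lift ord_max j)], f ord_max)) => [[g x] _|f _] /=.
  congr (_, _); last exact: ffun_rcons_max.
  by apply/ffunP => j; rewrite !ffunE liftK.
apply/ffunP => i; rewrite ffunE; case: unliftP => [j ->|-> //].
by rewrite ffunE.
Qed.

(* The solution of [m T_m = \sum_k A_k T_(m-k)], [T_0 = 1], split according to
   the number of steps. *)
Fixpoint iter_sol (K : fieldType) (A : nat -> {poly K}) (l m : nat) : {poly K} :=
  if l is l'.+1
  then m%:R^-1 *: \sum_(k < m.+1) A k * iter_sol A l' (m - k)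
  else (m == 0%N)%:R.

Lemma iter_sol_gt (K : fieldType) (A : nat -> {poly K}) (l m : nat) :
  A 0%N = 0 -> (m < l)%N -> iter_sol A l m = 0.
Proof.
move=> A0; elim: l m => // l IH m ml /=.
rewrite big1 ?scaler0 // => k _; have lt_k := ltn_ord k; case: (posnP k) => [->|k0].
  by rewrite A0 mul0r.
by rewrite IH ?mulr0 //; lia.
Qed.

(** The outermost step of [iter_sol] is the last part of the composition: at each step the current m
    is the partial sum k_1 + ... + k_j, whose inverse is the factor of that step. *)
Lemma iter_solE (K : fieldType) (A : nat -> {poly K}) (B l m : nat) : (m <= B)%N ->
  \sum_(k : {ffun 'I_l -> 'I_B.+1} | (\sum_i k i == m)%N)
    (\prod_(j < l) (\sum_(i < l | (i <= j)%N) k i)%:R^-1) *: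
    \prod_(j < l) A (k j) = iter_sol A l m.
Proof.
elim: l m => [|l IH] m mB.
  rewrite big_mkcond (big_pred1 [ffun i => ord0]) => [|k] /=; last first.
    by apply/esym/eqP/ffunP => -[].
  by rewrite !big_ord0 scale1r eq_sym; case: eqP.
rewrite big_mkcond sum_ffun_rcons /=.
rewrite scaler_sumr (big_ord_widen B.+1 (fun k => m%:R^-1 *: (A k * iter_sol A l (m - k)))) //.
rewrite [RHS]big_mkcond; apply: eq_bigr => x _ /=.
have sumE g : (\sum_i ffun_rcons g x i = \sum_i g i + x)%N.
  rewrite big_ord_recr /= ffun_rcons_max; congr (_ + _)%N.
  by apply: eq_bigr => i _; rewrite ffun_rcons_widen.
case: ltnP => xm; last first.
  by rewrite big1 // => g _; rewrite sumE ifF //; lia.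
rewrite -IH; last by lia.
rewrite mulr_sumr scaler_sumr [RHS]big_mkcond; apply: eq_bigr => g _ /=.
rewrite sumE (_ : (_ + _ == _)%N = (\sum_i g i == m - x)%N); last by apply/idP/idP; lia.
case: eqP => // gx.
have all_le : (\sum_(i < l.+1 | (i <= l)%N) ffun_rcons g x i = m)%N.
  rewrite (eq_bigl xpredT) => [|i]; first by rewrite sumE gx subnK.
  by rewrite -ltnS ltn_ord.
have partial j : (j < l)%N ->
    (\sum_(i < l.+1 | (i <= j)%N) ffun_rcons g x i = \sum_(i < l | (i <= j)%N) g i)%N.
  move=> jl; rewrite big_mkcond big_ord_recr /= leqNgt jl addn0 [RHS]big_mkcond.
  by apply: eq_bigr => i _ /=; rewrite ffun_rcons_widen.
rewrite big_ord_recr [X in _ *: X]big_ord_recr /= all_le ffun_rcons_max.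
rewrite -scalerAr scalerA mulrC; congr (_ * _ *: _).
  by apply: eq_bigr => j _; rewrite partial.
by rewrite mulrC; congr (_ * _); apply: eq_bigr => j _; rewrite ffun_rcons_widen.
Qed.

(* The recursion makes [T] the coefficients of [exp (\sum_k eps k y^k)], so that any
   derivation acts on [T] through its action on the exponent; here it is
   ['X d/d'X]. *)
Lemma euler_deriv_rec (K : fieldType) (p M : nat) (eps T : nat -> {poly K}) :
  p \in [pchar K] -> (M < p)%N -> eps 0%N = 0 -> T 0%N = 1 ->
  (forall m, (0 < m <= M)%N -> m%:R * T m = \sum_(k < m.+1) k%:R * eps k * T (m - k)%N) ->
  forall m, (m <= M)%N ->
    'X * (T m)^`() = \sum_(k < m.+1) 'X * (eps k)^`() * T (m - k)%N.
Proof.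
move=> pK Mp eps0 T0 TP; elim/ltn_ind => m IH mM.
case: (posnP m) => [->|m0].
  by rewrite big_ord1 eps0 T0 linear0 -(polyC1 K) derivC !mulr0 mul0r.
have pR : p \in [pchar {poly K}] by rewrite pchar_poly.
have m_neq0 := @natr_neq0_ltp {poly K} p m pR ltac:(lia).
have TD : m%:R * ('X * (T m)^`()) =
    \sum_(k < m.+1) (k%:R * ('X * (eps k)^`()) * T (m - k)%N +
      k%:R * eps k * ('X * (T (m - k)%N)^`())).
  have := TP m ltac:(lia) => /(congr1 (fun q => 'X * q^`())).
  rewrite derivM -polyC_natr derivC mul0r add0r mulrCA polyC_natr => ->.
  rewrite linear_sum /= mulr_sumr; apply: eq_bigr => k _.
  rewrite !derivM -polyC_natr derivC; ring.
apply: (mulfI m_neq0); rewrite TD big_split /=.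
(* The induction hypothesis replaces each derivative of T; after exchanging the sums, the inner one
   folds back into (m - j) T_(m-j), and k + (m - k) = m concludes. *)
have -> : \sum_(k < m.+1) k%:R * eps k * ('X * (T (m - k)%N)^`()) =
    \sum_(j < m.+1) (m - j)%:R * ('X * (eps j)^`() * T (m - j)%N).
  transitivity (\sum_(k < m.+1) \sum_(j < (m - k).+1)
      'X * (eps j)^`() * (k%:R * eps k * T (m - j - k)%N)).
    apply: eq_bigr => k _; have lt_k := ltn_ord k.
    case: (posnP k) => [->|k0].
      by rewrite eps0 mulr0 mul0r big1 // => j _; rewrite mul0r mulr0.
    rewrite IH; [|lia|lia]; rewrite mulr_sumr; apply: eq_bigr => j _.
    rewrite subnAC; ring.
  rewrite (sum_triangle m (fun k j => 'X * (eps j)^`() * (k%:R * eps k * T (m - j - k)%N))).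
  apply: eq_bigr => j _; rewrite -mulr_sumr [RHS]mulrCA; congr (_ * _).
  have lt_j := ltn_ord j.
  case: (posnP (m - j)) => [->|mj]; last by rewrite TP //; lia.
  by rewrite big_ord1 !mul0r.
rewrite -big_split /= mulr_sumr; apply: eq_bigr => k _; have lt_k := ltn_ord k.
rewrite natrB; [ring | lia].
Qed.

(** When [A 0] is 0 each step is at least 1, so the terms with l > m vanish and any B > m gives the
    full solution. *)
Definition comp_sol (K : fieldType) (A : nat -> {poly K}) (B m : nat) : {poly K} :=
  \sum_(l < B) iter_sol A l m.

Lemma comp_sol0 (K : fieldType) (A : nat -> {poly K}) (B : nat) :
  A 0%N = 0 -> comp_sol A B.+1 0 = 1.
Proof.
move=> A0; rewrite /comp_sol big_ord_recl big1 ?addr0 // => l _.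
by rewrite iter_sol_gt.
Qed.

Lemma comp_sol_rec (K : fieldType) (p : nat) (A : nat -> {poly K}) (B m : nat) :
  p \in [pchar K] -> A 0%N = 0 -> (0 < m < B)%N -> (m < p)%N ->
  m%:R * comp_sol A B m = \sum_(k < m.+1) A k * comp_sol A B (m - k).
Proof.
move=> pK A0 mB mp; have m0 := @natr_neq0_ltp K p m pK ltac:(lia).
case: B mB => [|B] mB; first by lia.
rewrite /comp_sol big_ord_recl /= (_ : (m == 0)%N = false) ?add0r; last by lia.
rewrite -scaler_sumr -polyC_natr mul_polyC scalerA mulfV // scale1r exchange_big /=.
apply: eq_bigr => k _; have lt_k := ltn_ord k; rewrite mulr_sumr big_ord_recr /=.
case: (posnP k) => [->|k0].
  by rewrite A0 mul0r addr0.
by rewrite [iter_sol A B _]iter_sol_gt // ?mulr0 ?addr0 //; lia.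
Qed.

(** * The identity over a field of characteristic p *)


(** A polynomial in t; divided by k it is the coefficient of y^k in the exponent of the generating
    function, up to degree N in t. *)
Definition weight_poly (K : fieldType) (beta : nat -> K) (N k : nat) : {poly K} :=
  \poly_(a < N.+1) (('C(k + a - 1, a)%:R - 'C(k, a)%:R) * beta a).

Lemma weight_poly0 (K : fieldType) (beta : nat -> K) (N : nat) :
  beta 0%N = 0 -> weight_poly beta N 0 = 0.
Proof.
move=> b0; apply/polyP => a; rewrite coef_poly coef0; case: ifP => // _.
case: a => [|a]; first by rewrite b0 mulr0.
by rewrite add0n subn1 bin_small // bin0n subrr mul0r.
Qed.

(** [comp_sol] solves an equation in y; [euler_deriv_rec] with exponents A_k / k trades it for an
    equation in t, whose coefficient of t^n is this recursion. *)
Lemma comp_sol_coef_rec (K : fieldType) (p : nat) (beta : nat -> K) (N B n m : nat) :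
  p \in [pchar K] -> beta 0%N = 0 -> (m < p)%N -> (m <= B)%N -> (n <= N)%N ->
  let T m n := (comp_sol (weight_poly beta N) B.+1 m)`_n in
  n%:R * T m n = \sum_(a < n.+1) \sum_(k < m.+1)
     a%:R * (k%:R^-1 * (('C(k + a - 1, a)%:R - 'C(k, a)%:R) * beta a))
       * T (m - k)%N (n - a)%N.
Proof.
move=> pK b0 mp mB nN /=; set A := weight_poly beta N.
have A0 : A 0%N = 0 by apply: weight_poly0.
pose eps k := k%:R^-1 *: A k.
have epsE k : (k < p)%N -> k%:R * eps k = A k.
  move=> kp; rewrite -polyC_natr mul_polyC scalerA.
  case: (posnP k) => [->|k0]; first by rewrite A0 scaler0.
  by rewrite mulfV ?scale1r // (natr_neq0_ltp pK) ?k0.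
have XD q i : ('X * q^`() : {poly K})`_i = i%:R * q`_i.
  by rewrite coefXM coef_deriv; case: i => [|i] /=; rewrite ?mul0r // mulr_natl.
have := @euler_deriv_rec K p m eps (comp_sol A B.+1) pK mp _ _ _ m (leqnn m).
move=> /(_ _ _ _) H.
rewrite -XD H; first last.
- move=> k km; rewrite (comp_sol_rec pK A0); [|lia|lia].
  by apply: eq_bigr => j _; have lt_j := ltn_ord j; rewrite epsE //; lia.
- by rewrite comp_sol0.
- by rewrite /eps A0 scaler0.
rewrite exchange_big coef_sum; apply: eq_bigr => k _ /=.
rewrite coefM; apply: eq_bigr => a _; have lt_a := ltn_ord a.
by rewrite XD coefZ coef_poly ifT //; lia.
Qed.

(** Both sides satisfy the same recursion in n, and for n = 0 both are 1 at m = 0 and 0 at m > 0. *)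
Lemma coef_comp_sol (K : fieldType) (p : nat) (b : nat -> K) (N B n m : nat) :
  p \in [pchar K] -> bern_rec b p.-2 ->
  (forall k, (1 < k <= p.-2)%N -> odd k -> b k = 0) ->
  odd p -> (N < p - 2)%N -> (B < p)%N -> (m <= B)%N -> (n <= N)%N ->
  (exp_coef K p n * geom K B ^+ n)`_m =
  (comp_sol (weight_poly (beta_coef p b) N) B.+1 m)`_n.
Proof.
move=> pK bP b_odd p_odd Np Bp; have p0 := prime_gt0 (pcharf_prime pK).
elim/ltn_ind: n m => n IH m mB nN.
set A := weight_poly _ _; have A0 : A 0%N = 0 by apply: weight_poly0.
case: (posnP n) => [->|n0].
  have -> : exp_coef K p 0 = 1.
    rewrite /exp_coef fact0 invr1 scale1r expr0; apply/polyP => k.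
    by rewrite coef_ptrace // !coef1 muln_eq0 [p == 0%N]gtn_eqF // orbF.
  rewrite expr0 mulr1 coef1; case: (posnP m) => [->|m0].
    by rewrite comp_sol0 // coef1.
  have m_neq0 := @natr_neq0_ltp K p m pK ltac:(lia).
  apply: (mulfI m_neq0); rewrite -[in RHS]coefCM polyC_natr (comp_sol_rec pK A0); [|lia|lia].
  rewrite coef_sum big1 ?(gtn_eqF m0) ?mulr0 // => k _.
  by rewrite coef0M coef_poly /= mulr0 mul0r.
have n_neq0 := @natr_neq0_ltp K p n pK ltac:(lia).
apply: (mulfI n_neq0).
rewrite (exp_coef_geom_rec (M := B) pK bP b_odd p_odd); [|lia|lia|lia].
rewrite (comp_sol_coef_rec pK) //; last by lia.
apply: eq_bigr => a _; apply: eq_bigr => k _; have lt_a := ltn_ord a.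
case: (posnP a) => [->|a0]; first by rewrite !mul0r.
by rewrite IH //; lia.
Qed.

(** The right-hand side of the theorem over an arbitrary ring, so that ring morphisms can carry it
    between A_1, the product and its factors. *)
Definition comp_formula (R : comNzRingType) (n m : nat) (c : R) (w beta : nat -> R) : R :=
  c * \sum_(1 <= l < (n %/ 3).+1)
   \sum_(k in compositions l m)
    \sum_(a in odd_compositions l n)
      (\prod_(j < l.-1) w (\sum_(i < l | (i <= j)%N) k i)%N) *
      \prod_(j < l) (('C(k j + a j - 1, a j)%:R - 'C(k j, a j)%:R) * beta (a j)).

Lemma rmorph_comp_formula (R S : comNzRingType) (f : {rmorphism R -> S}) n m c w beta :
  f (comp_formula n m c w beta) = comp_formula n m (f c) (f \o w) (f \o beta).
Proof.
rewrite rmorphM rmorph_sum; congr (_ * _); apply: eq_bigr => l _.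
rewrite rmorph_sum; apply: eq_bigr => k _.
rewrite rmorph_sum; apply: eq_bigr => a _.
rewrite rmorphM !rmorph_prod; congr (_ * _); apply: eq_bigr => j _ //=.
by rewrite rmorphM rmorphB !rmorph_nat.
Qed.

Lemma eq_comp_formula (R : comNzRingType) n m (c : R) w w' beta beta' :
  (forall s, (s <= m)%N -> w s = w' s) ->
  (forall a, (3 <= a <= n)%N -> odd a -> beta a = beta' a) ->
  comp_formula n m c w beta = comp_formula n m c w' beta'.
Proof.
move=> ww bb; congr (_ * _); apply: eq_bigr => l _.
apply: eq_bigr => k; rewrite inE => /andP[_ /eqP k_m].
apply: eq_bigr => a; rewrite inE => /andP[/forallP a_odd _].
congr (_ * _); apply: eq_bigr => j _.
  by apply: ww; rewrite -[X in (_ <= X)%N]k_m big_mkcond leq_sum // => i _; case: ifP.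
have /andP[a3 aj] := a_odd j; rewrite bb // a3.
by rewrite -ltnS ltn_ord.
Qed.

Lemma coef_iter_sol (K : fieldType) (beta : nat -> K) (n m l : nat) :
  (0 < m)%N -> (forall a, ~~ ((3 <= a)%N && odd a) -> beta a = 0) ->
  (iter_sol (weight_poly beta n) l.+1 m)`_n =
  m%:R^-1 * \sum_(k in compositions l.+1 m) \sum_(a in odd_compositions l.+1 n)
      (\prod_(j < l) (\sum_(i < l.+1 | (i <= j)%N) k i)%:R^-1) *
      \prod_(j < l.+1) (('C(k j + a j - 1, a j)%:R - 'C(k j, a j)%:R) * beta (a j)).
Proof.
move=> m0 b0.
have A0 : weight_poly beta n 0 = 0 by apply/weight_poly0/b0.
rewrite -(iter_solE _ _ (leqnn m)) coef_sum mulr_sumr.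
rewrite [LHS]big_mkcond [RHS]big_mkcond; apply: eq_bigr => k _ /=.
rewrite inE; case: eqP => k_m; rewrite ?andbF // andbT; case: forallP => k0; last first.
  move/forallP: k0; rewrite negb_forall => /existsP[j].
  rewrite -eqn0Ngt => /eqP kj.
  by rewrite [X in _ *: X](bigD1 j) //= kj A0 mul0r scaler0 coef0.
rewrite coefZ coef_prod_poly.
(* The last partial sum is m; its inverse leaves the product as the factor 1 / m. *)
rewrite big_ord_recr /= (_ : \sum_(i < l.+1 | _) _ = m)%N; last first.
  by apply: etrans k_m; apply: eq_bigl => i; rewrite -ltnS ltn_ord.
rewrite -mulrA mulrCA; congr (_ * _); rewrite mulr_sumr.
rewrite [LHS]big_mkcond [RHS]big_mkcond; apply: eq_bigr => a _ /=.
rewrite inE; case: eqP => a_n; rewrite ?andbF // andbT; case: forallP => // a_odd.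
move/forallP: a_odd; rewrite negb_forall => /existsP[j aj].
by rewrite (bigD1 j) //= (b0 (a j)) // mulr0 mul0r mulr0.
Qed.

Lemma sum_inv_prodE (K : fieldType) (p : nat) (b : nat -> K) (n m : nat) :
  p \in [pchar K] -> bern_rec b p.-2 ->
  (forall k, (1 < k <= p.-2)%N -> odd k -> b k = 0) ->
  odd p -> (0 < n)%N -> (0 < m)%N -> (n + m < p - 2)%N ->
  \sum_(f : {ffun 'I_n -> 'I_(m * p).+1} | (\sum_i f i == m * p)%N)
    \prod_i (f i)%:R^-1 =
  comp_formula n m (n`!%:R / m%:R) (fun s => s%:R^-1) (beta_coef p b).
Proof.
move=> pK bP b_odd p_odd n0 m0 nm_p; rewrite (sum_inv_prod _ _ pK).
(* A common truncation order: at least m and n / 3, and below p. *)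
pose B := (n + m)%N; set beta := beta_coef p b.
have beta0 a : ~~ ((3 <= a)%N && odd a) -> beta a = 0.
  by move=> /negbTE a_odd; rewrite /beta /beta_coef a_odd.
have nf0 : n`!%:R != 0 :> K by apply: (fact_neq0 pK); lia.
have -> : (ptrace p (log_poly K p ^+ n) * geom K m ^+ n)`_m =
    n`!%:R * (exp_coef K p n * geom K B ^+ n)`_m.
  rewrite /exp_coef -scalerAl coefZ mulVKf //.
  apply: (@eq_coef_ltMl _ m.+1) => //; apply: eq_coef_ltX => k km.
  by rewrite !coef_poly km ifT // /B; lia.
rewrite (coef_comp_sol (N := n) pK bP b_odd p_odd) //; [|lia|rewrite /B; lia|rewrite /B; lia].
rewrite /comp_formula -mulrA; congr (_ * _); rewrite coef_sum big_ord_recl /=.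
rewrite (_ : (m == 0)%N = false) ?coef0 ?add0r; last by lia.
rewrite mulr_sumr big_add1 /=.
rewrite -(big_mkord xpredT (fun l => (iter_sol (weight_poly beta n) l.+1 m)`_n)).
rewrite (@big_cat_nat _ _ _ (n %/ 3)) //=; last by rewrite /B; lia.
(* More than n / 3 parts, each at least 3, cannot sum to n. *)
rewrite [X in _ + X]big_nat [X in _ + X]big1 ?addr0 => [|l l_n]; last first.
  rewrite coef_iter_sol // big1 ?mulr0 // => k _; rewrite big1 // => a.
  rewrite inE => /andP[/forallP a3 /eqP a_n].
  have : (\sum_(j < l.+1) 3 <= n)%N.
    by rewrite -[X in (_ <= X)%N]a_n leq_sum // => j _; case/andP: (a3 j).
  by rewrite sum_nat_const card_ord; lia.
by apply: eq_bigr => l _; rewrite coef_iter_sol.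
Qed.

(** * Reduction of rationals and transfer to the ring A_1 *)


(* [x] is integral at the characteristic of [K], with reduction [z]. *)
Definition reduces (K : fieldType) (x : rat) (z : K) :=
  exists a b : int, [/\ b%:~R != 0 :> K, x * b%:~R = a%:~R & z * b%:~R = a%:~R].

(** By Gauss's lemma the reduced denominator of x divides b, hence is nonzero in K, and [ratr] is a
    true quotient. *)
Lemma ratr_reduces (K : fieldType) (x : rat) (z : K) : reduces x z -> ratr x = z.
Proof.
case=> a [b [b0 xb zb]].
have E : numq x * b = a * denq x.
  apply: (@intr_inj rat); rewrite !rmorphM /= -xb numqE; ring.
have : (denq x %| b)%Z.
  rewrite -(@Gauss_dvdzr _ (numq x)); first by rewrite E dvdz_mull.
  rewrite coprimez_sym /coprimez /gcdz.
  by have := coprime_num_den x; rewrite /coprime => /eqP ->.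
case/dvdzP => c bE.
have d0 : (denq x)%:~R != 0 :> K.
  by apply: contraNneq b0 => d0; rewrite bE rmorphM /= d0 mulr0.
apply: (mulIf b0); rewrite zb /ratr; apply: (mulIf d0).
by rewrite mulrAC divfK // -!rmorphM /= E.
Qed.

Lemma reduces_uniq (K : fieldType) (x : rat) (z z' : K) :
  reduces x z -> reduces x z' -> z = z'.
Proof. by move=> /ratr_reduces <- /ratr_reduces. Qed.

Lemma reducesD (K : fieldType) (x y : rat) (z t : K) :
  reduces x z -> reduces y t -> reduces (x + y) (z + t).
Proof.
move=> [a [b [b0 xb zb]]] [c [d [d0 yd td]]].
exists (a * d + c * b), (b * d); rewrite !(rmorphM, rmorphD) /= -xb -zb -yd -td.
by split; [rewrite mulf_neq0|ring|ring].
Qed.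

Lemma reducesM (K : fieldType) (x y : rat) (z t : K) :
  reduces x z -> reduces y t -> reduces (x * y) (z * t).
Proof.
move=> [a [b [b0 xb zb]]] [c [d [d0 yd td]]].
exists (a * c), (b * d); rewrite !rmorphM /= -xb -zb -yd -td.
by split; [rewrite mulf_neq0|ring|ring].
Qed.

Lemma reducesN (K : fieldType) (x : rat) (z : K) :
  reduces x z -> reduces (- x) (- z).
Proof.
move=> [a [b [b0 xb zb]]]; exists (- a), b.
by rewrite !rmorphN /= -xb -zb !mulNr.
Qed.

Lemma reduces_nat (K : fieldType) (n : nat) : reduces n%:R (n%:R : K).
Proof. by exists n, 1; rewrite !mulr1 oner_neq0. Qed.

Lemma reduces_natV (K : fieldType) (n : nat) :
  n%:R != 0 :> K -> reduces n%:R^-1 (n%:R^-1 : K).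
Proof.
move=> n0; exists 1, n; split => //; apply: mulVf => //.
by rewrite pnatr_eq0; apply: contraNneq n0 => ->.
Qed.

Lemma reduces_sum (K : fieldType) (I : Type) (r : seq I) (P : pred I)
    (F : I -> rat) (G : I -> K) : (forall i, P i -> reduces (F i) (G i)) ->
  reduces (\sum_(i <- r | P i) F i) (\sum_(i <- r | P i) G i).
Proof.
move=> FG; elim/big_rec2: _ => [|i x y Pi]; first exact: (reduces_nat K 0).
by apply: reducesD; apply: FG.
Qed.

Lemma reduces_prod (K : fieldType) (I : Type) (r : seq I) (P : pred I)
    (F : I -> rat) (G : I -> K) : (forall i, P i -> reduces (F i) (G i)) ->
  reduces (\prod_(i <- r | P i) F i) (\prod_(i <- r | P i) G i).
Proof.
move=> FG; elim/big_rec2: _ => [|i x y Pi]; first exact: (reduces_nat K 1).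
by apply: reducesM; apply: FG.
Qed.

Lemma bernoulli_rec (N : nat) : bern_rec bernoulli N.
Proof. by move=> n _; apply: bernoulliP. Qed.

(** The recurrence for B_k divides only by k + 1 <= p - 1, so integrality follows by strong
    induction. *)
Lemma reduces_bernoulli (K : fieldType) (p k : nat) : p \in [pchar K] ->
  (k <= p.-2)%N -> reduces (bernoulli k) (ratr (bernoulli k) : K).
Proof.
move=> pK; have p1 := prime_gt1 (pcharf_prime pK).
elim/ltn_ind: k => k IH kp.
have k0 := @natr_neq0_ltp K p k.+1 pK ltac:(lia).
have kQ : k.+1%:R != 0 :> rat by rewrite pnatr_eq0.
have E0 := bernoulliP k; rewrite big_ord_recr /= binSn in E0.
have : bernoulli k = k.+1%:R^-1 * ((k == 0%N)%:R - \sum_(i < k) 'C(k.+1, i)%:R * bernoulli i).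
  by apply: (mulfI kQ); rewrite mulVKf // -E0 addrAC subrr add0r.
set x := (X in _ = X) => E.
suff [z xz] : exists z : K, reduces x z by rewrite E (ratr_reduces xz).
eexists; apply: reducesM (reduces_natV k0) _.
apply: reducesD (reduces_nat _ _) (reducesN _).
apply: reduces_sum => i _; have lt_i := ltn_ord i.
by apply: reducesM (reduces_nat _ _) (IH _ _ _); lia.
Qed.

Lemma ratr_bernoulli_rec (K : fieldType) (p : nat) : p \in [pchar K] ->
  bern_rec (fun k => ratr (bernoulli k) : K) p.-2.
Proof.
move=> pK n np.
apply: (@reduces_uniq _ (n == 0%N)%:R _ _ _ (reduces_nat _ _)).
rewrite -(bernoulliP n); apply: reduces_sum => i _; have lt_i := ltn_ord i.
by apply: reducesM (reduces_nat _ _) (reduces_bernoulli pK _); lia.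
Qed.

Lemma reduces_Rsum (K : fieldType) (p n m : nat) : p \in [pchar K] ->
  reduces (Rsum n m p 1)
    (\sum_(f : {ffun 'I_n -> 'I_(m * p).+1} | (\sum_i f i == m * p)%N)
      \prod_i (f i)%:R^-1 : K).
Proof.
move=> pK.
have -> : \sum_(f : {ffun 'I_n -> 'I_(m * p).+1} | (\sum_i f i == m * p)%N)
      \prod_i (f i)%:R^-1 = \sum_(f : {ffun 'I_n -> 'I_(m * p ^ 1).+1}
         | [forall i, (0 < f i)%N && ~~ (p %| f i)%N]
           && (\sum_i f i == m * p ^ 1)%N) (\prod_i (f i)%:R^-1) :> K.
  rewrite /= [LHS]big_mkcond [RHS]big_mkcond; apply: eq_bigr => f _ /=.
  rewrite andbC; case: eqP => //= _; case: forallP => // /forallP.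
  rewrite negb_forall => /existsP[j fj]; rewrite (bigD1 j) //=.
  have -> : (f j)%:R = 0 :> K.
    apply/eqP; rewrite -(dvdn_pcharf pK); move: fj; rewrite negb_and negbK.
    by rewrite -eqn0Ngt => /orP[/eqP ->|].
  by rewrite invr0 mul0r.
apply: reduces_sum => f /andP[/forallP f_p _].
rewrite -prodfV; apply: reduces_prod => i _; apply: reduces_natV.
by rewrite -(dvdn_pcharf pK); case/andP: (f_p i).
Qed.

Lemma ratr_RsumE (K : fieldType) (p n m : nat) : p \in [pchar K] ->
  odd p -> (0 < n)%N -> (0 < m)%N -> (n + m < p - 2)%N ->
  ratr (Rsum n m p 1) = comp_formula n m (ratr (n`!%:R / m%:R))
    (fun s => ratr s%:R^-1)
    (fun a => ratr (if (a < p)%N then - bernoulli (p - a) / a%:R else 0)) :> K.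
Proof.
move=> pK p_odd n0 m0 nm_p.
have nz k : (0 < k < p)%N -> k%:R != 0 :> K by apply: natr_neq0_ltp pK.
rewrite (ratr_reduces (reduces_Rsum n m pK)).
rewrite (sum_inv_prodE pK (ratr_bernoulli_rec pK)) //; last first.
  move=> k k_p k_odd; rewrite (bern_odd0 (@bernoulli_rec k)) //; last by lia.
  exact: (ratr_reduces (reduces_nat K 0)).
have -> : ratr (n`!%:R / m%:R) = n`!%:R / m%:R :> K.
  by apply/ratr_reduces/reducesM/reduces_natV/nz; [exact: reduces_nat | lia].
apply: eq_comp_formula => [s sm|a a_n a_odd].
  case: (posnP s) => [->|s0].
    by rewrite !invr0 (ratr_reduces (reduces_nat K 0)).
  by symmetry; apply/ratr_reduces/reduces_natV/nz; lia.
rewrite /beta_coef a_odd andbT !ifT; [|lia|lia].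
symmetry; apply/ratr_reduces/reducesM; last by apply/reduces_natV/nz; lia.
by apply/reducesN/(reduces_bernoulli pK); lia.
Qed.

(** * Evaluation at a prime and passage to the quotient *)

Definition eval_prodZ (l : nat) (p : primeT) (f : prodZ l) : 'Z_(sval p ^ l) := f p.

HB.instance Definition _ l p := GRing.isZmodMorphism.Build (prodZ l) 'Z_(sval p ^ l)
  (@eval_prodZ l p) (fun f g => erefl).
HB.instance Definition _ l p := GRing.isMonoidMorphism.Build (prodZ l) 'Z_(sval p ^ l)
  (@eval_prodZ l p) (conj erefl (fun f g => erefl)).

Definition pi_prodZ (l : nat) (f : prodZ l) : A_ l := \pi_(A_ l)%qT f.

HB.instance Definition _ l := GRing.isZmodMorphism.Build (prodZ l) (A_ l)
  (@pi_prodZ l) (@pi_is_zmod_morphism _ _ _ {ideal_quot (dsumZ l)}).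
HB.instance Definition _ l := GRing.isMonoidMorphism.Build (prodZ l) (A_ l)
  (@pi_prodZ l) (@pi_is_monoid_morphism _ _ _ {ideal_quot (dsumZ l)}).

Lemma pi_prodZ_eq (l N : nat) (f g : prodZ l) :
  (forall p : primeT, (N < sval p)%N -> eval_prodZ p f = eval_prodZ p g) ->
  pi_prodZ f = pi_prodZ g.
Proof.
move=> fg; apply/eqP; rewrite /pi_prodZ -Quotient.idealrBE; apply/dsumZP; exists N => p Np.
by rewrite -[LHS]/(eval_prodZ p (f - g)) rmorphB /= fg // subrr.
Qed.

Theorem theorem3p3 (m n : nat) (hm : (0 < m)%N) (hn : (0 < n)%N) :
  RA n m 1 =
  ratA 1 (n`!%:R / m%:R) *
  \sum_(1 <= l < (n %/ 3).+1)
   \sum_(k in compositions l m)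
    \sum_(a in odd_compositions l n)
      (\prod_(j < l.-1) ratA 1 (\sum_(i < l | (i <= j)%N) k i)%:R^-1) *
      \prod_(j < l)
        (('C(k j + a j - 1, a j)%:R - 'C(k j, a j)%:R) * bA (a j)).
Proof.
pose c : prodZ 1 := fun=> ratr (n`!%:R / m%:R).
pose w s : prodZ 1 := fun=> ratr s%:R^-1.
pose beta a : prodZ 1 :=
  fun p => ratr (if (a < sval p)%N then - bernoulli (sval p - a) / a%:R else 0).
(* The right-hand side is the class of a family computed coordinatewise, so comparing coordinates at
   large p suffices. *)
transitivity (pi_prodZ (comp_formula n m c w beta)); last first.
  by rewrite rmorph_comp_formula.
(* Beyond n + m + 2, p is odd and n + m < p - 2. *)
apply: (@pi_prodZ_eq _ (n + m + 2)) => -[p p_pr] /= p_big.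
have p_odd : odd p by case: (even_prime p_pr) => // p2; lia.
(* ['F_p] is ['Z_(pdiv p)], so this equation turns ['Z_(p ^ 1)] into a field. *)
have p1_pdiv : (p ^ 1 = pdiv p)%N by rewrite expn1 pdiv_id.
rewrite rmorph_comp_formula.
change (ratr (Rsum n m p 1) = comp_formula n m (ratr (n`!%:R / m%:R))
  (fun s => ratr s%:R^-1)
  (fun a => ratr (if (a < p)%N then - bernoulli (p - a) / a%:R else 0))
  :> 'Z_(p ^ 1)).
by rewrite p1_pdiv; apply: ratr_RsumE => //; [exact: pchar_Fp | lia].
Qed.
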